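(* Let $d=2$ and let $\mathcal D\subseteq\mathbb S_1^1$ be a half-open interval (arc) of arclength $\tau>\pi$. Then for any unimodular lattice $\mathcal L\subset\mathbb R^2$, $\vec\alpha\in\mathbb R^2$ and $N\in\mathbb N$, $$g_N(\mathcal D,\vec\alpha,\mathcal L)\le\begin{cases}5 & \text{if } \tau=2\pi,\\ 9 & \text{if } 5\pi/3<\tau<2\pi,\\ 8 & \text{if } \tau=5\pi/3,\\ 9 & \text{if } 4\pi/3<\tau<5\pi/3,\\ 8 & \text{if } \tau=4\pi/3,\\ 12+2\left\lfloor\frac{\sin(\tau/2+\pi/6)}{\sin(\tau-\pi)}\right\rfloor & \text{if } \pi<\tau<4\pi/3.\end{cases}$$
   Context: $\mathbb S_1^{d-1}$ is the unit sphere in $\mathbb R^d$ (here the unit circle). A unimodular lattice is a lattice of covolume $1$. For $\vec\alpha\in\mathbb R^d$, a unimodular lattice $\mathcal L$, a set $\mathcal D\subseteq\mathbb S_1^{d-1}$ and $1\le n\le N$, define the distance to the nearest neighbour in direction $\mathcal D$ by $$\delta_{n,N}(\mathcal D)=\min\{|(m-n)\vec\alpha+\vec\ell| : (m-n)\vec\alpha+\vec\ell\in\mathbb R_{>0}\mathcal D,\ 1\le m\le N,\ \vec\ell\in\mathcal L\}$$ (Euclidean norm), and $g_N(\mathcal D,\vec\alpha,\mathcal L)=|\{\delta_{n,N}(\mathcal D):1\le n\le N\}|$. *)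

(* Defs.v *)
From Stdlib Require Import Reals ZArith List.
Open Scope R_scope.

Definition norm2 (v : R * R) : R := sqrt (fst v ^ 2 + snd v ^ 2).

(* Membership in the open cone R_{>0} D, where D is the half-open arc of
   the unit circle  { (cos t, sin t) : t in [th0, th0+tau) }  if [lc] = true
   (closed at the start point) or  { (cos t, sin t) : t in (th0, th0+tau] }
   if [lc] = false (closed at the end point). Its arclength is tau. *)
Definition in_cone (th0 tau : R) (lc : bool) (v : R * R) : Prop :=
  exists s t : R, 0 < s /\
    (if lc then th0 <= t < th0 + tau else th0 < t <= th0 + tau) /\
    v = (s * cos t, s * sin t).

(* The lattice L = Z b1 + Z b2 with b1 = (a, b), b2 = (c, d). It is
   unimodular iff |a d - b c| = 1 (covolume 1). *)
Definition in_lattice (a b c d : R) (l : R * R) : Prop :=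
  exists i j : Z, l = (IZR i * a + IZR j * c, IZR i * b + IZR j * d).

Definition dist_set (th0 tau : R) (lc : bool) (a b c d : R) (alpha : R * R)
    (N n : nat) (r : R) : Prop :=
  exists (m : nat) (l : R * R),
    (1 <= m <= N)%nat /\ in_lattice a b c d l /\
    let v := ((INR m - INR n) * fst alpha + fst l,
              (INR m - INR n) * snd alpha + snd l) in
    in_cone th0 tau lc v /\ r = norm2 v.

Definition is_delta (th0 tau : R) (lc : bool) (a b c d : R) (alpha : R * R)
    (N n : nat) (r : R) : Prop :=
  dist_set th0 tau lc a b c d alpha N n r /\
  forall s, dist_set th0 tau lc a b c d alpha N n s -> r <= s.

(* g_N(D, alpha, L) <= K : the set { delta_{n,N}(D) : 1 <= n <= N } has at
   most K elements, i.e. is covered by a list of at most K reals. *)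
Definition gN_le (th0 tau : R) (lc : bool) (a b c d : R) (alpha : R * R)
    (N : nat) (K : Z) : Prop :=
  exists ls : list R, (Z.of_nat (length ls) <= K)%Z /\
    forall n : nat, (1 <= n <= N)%nat ->
      forall r, is_delta th0 tau lc a b c d alpha N n r -> In r ls.

(* Main.v *)
(* Write the points of the problem as projections of a lattice of R^3 whose
   points carry a height k = m - n, and let n be an index whose distance rho is
   the largest one. The window of heights of n is [-a, b]; reflecting heights
   we may assume b <= a. Every other distance is below rho, hence realised
   outside the window; flipping the realising points of negative height puts
   all of them at heights in [b + 1, a + b], so that differences of two of them
   fall in the window, with at least one orientation. Such a difference is
   therefore either of length at least rho, or a short vector of the gap, the
   complement of the cone. In the second case both the longer point (reflected)
   and the difference lie in the gap, at an angle of at least 2 PI / 3, which is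
   impossible if the gap has angle at most 2 PI / 3. Then all points are
   separated, and at most five vectors shorter than rho have mutual distances
   at least rho. For a larger gap, the exceptional points are close to one of
   the two edges of the gap, and near each edge a linear functional grows from
   one point to the next by at least the smallest norm times sin (tau - PI),
   while it is at most the smallest norm times sin (tau / 2 + PI / 6) at the
   last point; this bounds their number. For the full circle one more
   point has to be excluded: five separated points are distinct and nonzero
   modulo 2, hence have two triples with even sum, and half of a signed sum of a
   triple is a sixth separated point unless it is one of the five. *)

Require Import Defs.
From Stdlib Require Import Reals ZArith List.
From Stdlib Require Import Lra Lia Classical ClassicalEpsilon.
Import ListNotations.
Open Scope R_scope.

(** * Planar vectors, square norms and spaced real values *)

Definition vadd (v w : R * R) : R * R := (fst v + fst w, snd v + snd w).
Definition vsub (v w : R * R) : R * R := (fst v - fst w, snd v - snd w).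
Definition vopp (v : R * R) : R * R := (- fst v, - snd v).
Definition nsq (v : R * R) : R := fst v ^ 2 + snd v ^ 2.

Lemma nsq_vsubC (v w : R * R) : nsq (vsub v w) = nsq (vsub w v).
Proof. unfold nsq, vsub; simpl; ring. Qed.

Lemma vadd_vopp v w : vadd v (vopp w) = vsub v w.
Proof. unfold vadd, vopp, vsub; simpl; f_equal. Qed.

Lemma nsq_vopp v : nsq (vopp v) = nsq v.
Proof. unfold nsq, vopp; simpl; ring. Qed.

Lemma nsq_ge0 v : 0 <= nsq v.
Proof. unfold nsq. pose proof (pow2_ge_0 (fst v)). pose proof (pow2_ge_0 (snd v)). lra. Qed.

Lemma sum_sq_le0 x y : x ^ 2 + y ^ 2 <= 0 -> x = 0 /\ y = 0.
Proof.
  intro h. pose proof (pow2_ge_0 x). pose proof (pow2_ge_0 y).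
  split; apply Rsqr_0_uniq; rewrite Rsqr_pow2; lra.
Qed.

Lemma nsq_vsub_gt0 v w : v <> w -> 0 < nsq (vsub v w).
Proof.
  intro h. destruct (Rle_lt_or_eq_dec _ _ (nsq_ge0 (vsub v w))) as [|e]; [assumption|].
  exfalso. apply h. destruct v as [p q], w as [x y]; unfold nsq, vsub in e; cbn [fst snd] in e.
  destruct (sum_sq_le0 (p - x) (q - y)); [lra|]. f_equal; lra.
Qed.

(** By the parallelogram identity the square norms of the difference and of the sum add up to less
    than [4 * rho]. *)
Lemma nsq_sub_lt (rho : R) (v w : R * R) :
  nsq v < rho -> nsq w < rho -> nsq (vsub v w) < 4 * rho.
Proof.
  destruct v as [p q], w as [x y]; unfold nsq, vsub; simpl; intros.
  pose proof (pow2_ge_0 (p + x)). pose proof (pow2_ge_0 (q + y)). simpl in *. nra.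
Qed.

Lemma nsq_polar_add (s t s' t' : R) :
  nsq (vadd (s * cos t, s * sin t) (s' * cos t', s' * sin t')) =
  s ^ 2 + s' ^ 2 + 2 * (s * s' * cos (t - t')).
Proof.
  rewrite cos_minus. unfold nsq, vadd; cbn [fst snd].
  pose proof (sin2_cos2 t) as h. pose proof (sin2_cos2 t') as h'. unfold Rsqr in *.
  replace (s ^ 2) with (s ^ 2 * (sin t * sin t + cos t * cos t)) by (rewrite h; ring).
  replace (s' ^ 2) with (s' ^ 2 * (sin t' * sin t' + cos t' * cos t')) by (rewrite h'; ring).
  ring.
Qed.

Lemma nsq_polar (s t : R) : nsq (s * cos t, s * sin t) = s ^ 2.
Proof.
  unfold nsq; cbn [fst snd]. pose proof (sin2_cos2 t) as h. unfold Rsqr in h.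
  replace (s ^ 2) with (s ^ 2 * (sin t * sin t + cos t * cos t)) by (rewrite h; ring). ring.
Qed.

Lemma list_min (X : Type) (f : X -> R) (l : list X) : l <> [] ->
  exists m, In m l /\ forall x, In x l -> f m <= f x.
Proof.
  induction l as [|x l IH]; [congruence|]. intros _.
  destruct l as [|y l]; [exists x; simpl; split; auto; intros z [<-|[]]; lra|].
  destruct IH as (m & hm & h); [congruence|].
  destruct (Rle_lt_dec (f x) (f m)).
  - exists x. split; [left; auto|]. intros z [<-|hz]; [lra|]. apply h in hz. lra.
  - exists m. split; [right; auto|]. intros z [<-|hz]; [lra|]. auto.
Qed.

(** Values at mutual distance at least 1 have distinct integer parts, all among 0, ...,
    [Int_part r]. *)
Lemma spaced_length (X : Type) (g : X -> R) (r : R) (l : list X) :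
  0 <= r -> NoDup l -> (forall x, In x l -> 0 <= g x <= r) ->
  (forall x y, In x l -> In y l -> x <> y -> 1 <= Rabs (g x - g y)) ->
  (Z.of_nat (length l) <= 1 + Int_part r)%Z.
Proof.
  intros hr hnd hb hs.
  assert (mono : forall p q, p <= q -> (Int_part p <= Int_part q)%Z).
  { intros p q hpq. destruct (base_Int_part p), (base_Int_part q).
    apply Z.lt_succ_r. apply lt_IZR. unfold Z.succ. rewrite plus_IZR. lra. }
  assert (h0 : (0 <= Int_part r)%Z).
  { replace 0%Z with (Int_part 0); [apply mono; exact hr|]. symmetry. apply Int_part_spec. simpl; lra. }
  assert (h0g : forall x, In x l -> (0 <= Int_part (g x) <= Int_part r)%Z).
  { intros x hx. apply hb in hx. split; [|apply mono; lra].
    replace 0%Z with (Int_part 0); [apply mono; lra|]. symmetry. apply Int_part_spec. simpl; lra. }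
  assert (hnd' : NoDup (map (fun x => Z.to_nat (Int_part (g x))) l)).
  { apply NoDup_map_NoDup_ForallPairs; [|exact hnd]. intros x y hx hy e.
    apply NNPP. intro hxy. specialize (hs x y hx hy hxy).
    assert (e' : Int_part (g x) = Int_part (g y)).
    { pose proof (h0g x hx). pose proof (h0g y hy). lia. }
    destruct (base_Int_part (g x)), (base_Int_part (g y)). rewrite e' in *.
    unfold Rabs in hs. destruct Rcase_abs; lra. }
  assert (hincl : incl (map (fun x => Z.to_nat (Int_part (g x))) l)
                       (seq 0 (S (Z.to_nat (Int_part r))))).
  { intros n hn. apply in_map_iff in hn. destruct hn as (x & <- & hx).
    apply h0g in hx. apply in_seq. lia. }
  apply NoDup_incl_length in hincl; [|exact hnd'].
  rewrite length_map, length_seq in hincl. lia.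
Qed.

(** * Separated families in the plane *)

(** The square norm in coordinates with respect to two unit vectors at angle PI/3. *)
Definition hexq (x y : R) : R := x ^ 2 + x * y + y ^ 2.

(** For two vectors in a closed sector of angle PI/3, the side of the triangle opposite to their
    angle cannot be longer than both of them. *)
Lemma hexq_sub_le (x y z w : R) :
  0 <= x -> 0 <= y -> 0 <= z -> 0 <= w ->
  hexq (x - z) (y - w) <= Rmax (hexq x y) (hexq z w).
Proof.
  assert (key : forall x y z w, 0 <= x -> 0 <= y -> 0 <= z -> 0 <= w ->
    hexq z w <= hexq x y -> hexq (x - z) (y - w) <= hexq x y).
  { clear. intros x y z w hx hy hz hw h. unfold hexq in *.
    (* [B] is twice the inner product, so the claim amounts to [hexq z w <= B]. As the cosine is at
       least 1/2, [B * B] is at least the product of the two square norms ([hC]), so [B] cannot lie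
       below both. *)
    set (B := 2 * x * z + x * w + y * z + 2 * y * w).
    assert (hB : z ^ 2 + z * w + w ^ 2 <= B).
    { apply Rnot_lt_le. intro hlt.
      assert (hxz := Rmult_le_pos _ _ hx hz). assert (hxw := Rmult_le_pos _ _ hx hw).
      assert (hyz := Rmult_le_pos _ _ hy hz). assert (hyw := Rmult_le_pos _ _ hy hw).
      assert (hB0 : 0 <= B) by (unfold B; lra).
      assert (hQ0 : 0 <= z ^ 2 + z * w + w ^ 2) by (assert (0 <= z * w) by nra; nra).
      assert (hC : (x ^ 2 + x * y + y ^ 2) * (z ^ 2 + z * w + w ^ 2) <= B * B).
      { assert (B * B - (x ^ 2 + x * y + y ^ 2) * (z ^ 2 + z * w + w ^ 2) =
          3 * ((x * z) * (x * z) + (x * z) * (x * w) + (x * z) * (y * z)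
          + 3 * ((x * z) * (y * w)) + (x * w) * (y * w)
          + (y * z) * (y * w) + (y * w) * (y * w))) as e by (unfold B; ring).
        assert (0 <= (x * z) * (x * z)) by (apply Rmult_le_pos; auto).
        assert (0 <= (x * z) * (x * w)) by (apply Rmult_le_pos; auto).
        assert (0 <= (x * z) * (y * z)) by (apply Rmult_le_pos; auto).
        assert (0 <= (x * z) * (y * w)) by (apply Rmult_le_pos; auto).
        assert (0 <= (x * w) * (y * w)) by (apply Rmult_le_pos; auto).
        assert (0 <= (y * z) * (y * w)) by (apply Rmult_le_pos; auto).
        assert (0 <= (y * w) * (y * w)) by (apply Rmult_le_pos; auto).
        lra. }
      clearbody B. nra. }
    unfold B in hB. lra. }
  intros hx hy hz hw. destruct (Rle_lt_dec (hexq z w) (hexq x y)).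
  - apply Rle_trans with (hexq x y); [apply key; auto | apply Rmax_l].
  - apply Rle_trans with (hexq z w); [| apply Rmax_r].
    replace (hexq (x - z) (y - w)) with (hexq (z - x) (w - y)) by (unfold hexq; ring).
    apply key; auto; lra.
Qed.

(* [hexA e v] and [hexB e v] are, up to a common positive factor, the
   coordinates of [v] in the basis formed by [e] and its rotation by PI/3. *)
Definition hexA (e v : R * R) : R :=
  fst v * (sqrt 3 / 2 * fst e + snd e / 2) - snd v * (fst e / 2 - sqrt 3 / 2 * snd e).
Definition hexB (e v : R * R) : R := fst e * snd v - snd e * fst v.

Lemma hexq_coord (e v : R * R) :
  hexq (hexA e v) (hexB e v) = 3 / 4 * nsq e * nsq v.
Proof.
  assert (h3 : sqrt 3 * sqrt 3 = 3) by (apply sqrt_sqrt; lra).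
  transitivity (sqrt 3 * sqrt 3 / 4 * (fst e * fst v + snd e * snd v) ^ 2
                + 3 / 4 * (fst e * snd v - snd e * fst v) ^ 2).
  - unfold hexq, hexA, hexB. field.
  - rewrite h3. unfold nsq. field.
Qed.

Lemma hexA_sub (e v w : R * R) : hexA e (vsub v w) = hexA e v - hexA e w.
Proof. unfold hexA, vsub; simpl; ring. Qed.

Lemma hexB_sub (e v w : R * R) : hexB e (vsub v w) = hexB e v - hexB e w.
Proof. unfold hexB, vsub; simpl; ring. Qed.

(** Closed sectors of angle PI/3 in the coordinates of [hexq]: rotating back by PI/3 sends [(x, y)]
    to [(x + y, - x)], and sector [n] is what [n] such rotations carry to the first quadrant of
    coordinates. *)
Definition in_sextant (n : nat) (x y : R) : Prop :=
  match n with
  | 0%nat => 0 <= x /\ 0 <= y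
  | 1%nat => 0 <= x + y /\ 0 <= - x
  | 2%nat => 0 <= y /\ 0 <= - (x + y)
  | 3%nat => 0 <= - x /\ 0 <= - y
  | 4%nat => 0 <= - (x + y) /\ 0 <= x
  | _ => 0 <= - y /\ 0 <= x + y
  end.

Lemma in_sextant_exists (x y : R) : exists n, (n < 6)%nat /\ in_sextant n x y.
Proof.
  destruct (Rle_lt_dec 0 x), (Rle_lt_dec 0 y), (Rle_lt_dec 0 (x + y));
    (exists 0%nat; simpl; split; [lia | lra]) ||
    (exists 1%nat; simpl; split; [lia | lra]) ||
    (exists 2%nat; simpl; split; [lia | lra]) ||
    (exists 3%nat; simpl; split; [lia | lra]) ||
    (exists 4%nat; simpl; split; [lia | lra]) ||
    (exists 5%nat; simpl; split; [lia | lra]).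
Qed.

(** The form [hexq] is invariant under rotation by PI/3, which reduces every sector to the first
    one. *)
Lemma in_sextant_sub_le (n : nat) (x y z w : R) :
  in_sextant n x y -> in_sextant n z w ->
  hexq (x - z) (y - w) <= Rmax (hexq x y) (hexq z w).
Proof.
  assert (rot1 : forall x y, hexq x y = hexq (x + y) (- x)) by (intros; unfold hexq; ring).
  assert (rot2 : forall x y, hexq x y = hexq y (- (x + y))) by (intros; unfold hexq; ring).
  assert (rot3 : forall x y, hexq x y = hexq (- x) (- y)) by (intros; unfold hexq; ring).
  assert (rot4 : forall x y, hexq x y = hexq (- (x + y)) x) by (intros; unfold hexq; ring).
  assert (rot5 : forall x y, hexq x y = hexq (- y) (x + y)) by (intros; unfold hexq; ring).
  destruct n as [|[|[|[|[|n]]]]]; simpl; intros [h1 h2] [h3 h4].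
  - apply hexq_sub_le; auto.
  - rewrite (rot1 (x - z)), (rot1 x), (rot1 z).
    replace (x - z + (y - w)) with ((x + y) - (z + w)) by ring.
    replace (- (x - z)) with (- x - - z) by ring. apply hexq_sub_le; auto.
  - rewrite (rot2 (x - z)), (rot2 x), (rot2 z).
    replace (- (x - z + (y - w))) with (- (x + y) - - (z + w)) by ring.
    apply hexq_sub_le; auto.
  - rewrite (rot3 (x - z)), (rot3 x), (rot3 z).
    replace (- (x - z)) with (- x - - z) by ring.
    replace (- (y - w)) with (- y - - w) by ring. apply hexq_sub_le; auto.
  - rewrite (rot4 (x - z)), (rot4 x), (rot4 z).
    replace (- (x - z + (y - w))) with (- (x + y) - - (z + w)) by ring.
    apply hexq_sub_le; auto.
  - rewrite (rot5 (x - z)), (rot5 x), (rot5 z).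
    replace (x - z + (y - w)) with ((x + y) - (z + w)) by ring.
    replace (- (y - w)) with (- y - - w) by ring. apply hexq_sub_le; auto.
Qed.

Definition separated (rho : R) (l : list (R * R)) : Prop :=
  Forall (fun v => nsq v < rho) l /\
  ForallOrdPairs (fun v w => rho <= nsq (vsub v w)) l.

Lemma in_sextant_separated (rho : R) (n : nat) (e v w : R * R) :
  0 < nsq e -> nsq v < rho -> nsq w < rho -> rho <= nsq (vsub v w) ->
  in_sextant n (hexA e v) (hexB e v) -> in_sextant n (hexA e w) (hexB e w) -> False.
Proof.
  intros he hv hw hd h1 h2. pose proof (in_sextant_sub_le _ _ _ _ _ h1 h2) as h.
  rewrite <- hexA_sub, <- hexB_sub, !hexq_coord in h.
  revert h. apply Rmax_case; intro h.
  - assert (nsq e * nsq v < nsq e * nsq (vsub v w)) by (apply Rmult_lt_compat_l; lra). lra.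
  - assert (nsq e * nsq w < nsq e * nsq (vsub v w)) by (apply Rmult_lt_compat_l; lra). lra.
Qed.

(** Cut the plane into six sectors starting at the ray of the first vector [e]. No closed sector
    holds two separated vectors, and sectors 0 and 5 both contain [e], so the other vectors occupy
    distinct sectors among the four remaining ones. *)
Lemma separated_length (rho : R) (l : list (R * R)) :
  separated rho l -> (length l <= 5)%nat.
Proof.
  destruct l as [|e l]; [simpl; lia|]. intros [hF hP].
  inversion_clear hF as [|? ? he hF']. inversion_clear hP as [|? ? hd hP'].
  (* If [e] is zero, a second vector would have square norm both below [rho] and at least [rho]. *)
  destruct (Rle_lt_dec (nsq e) 0) as [h0|h0].
  { destruct l as [|v l]; [simpl; lia|]. exfalso.
    inversion_clear hF' as [|? ? hv _]. inversion_clear hd as [|? ? hev _].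
    destruct e as [p q]; unfold nsq, vsub in *; simpl in *.
    assert (p = 0) by nra. assert (q = 0) by nra. subst. nra. }
  set (sx := fun v => proj1_sig (constructive_indefinite_description _
                (in_sextant_exists (hexA e v) (hexB e v)))).
  assert (hsx : forall v, (sx v < 6)%nat /\ in_sextant (sx v) (hexA e v) (hexB e v)).
  { intro v. unfold sx. destruct constructive_indefinite_description as [n hn]; exact hn. }
  assert (he0 : hexB e e = 0) by (unfold hexB; ring).
  assert (hea : 0 <= hexA e e).
  { unfold hexA. pose proof (sqrt_lt_R0 3 ltac:(lra)) as h3.
    unfold nsq in h0.
    assert (0 <= sqrt 3 / 2 * (fst e ^ 2 + snd e ^ 2)) by (apply Rmult_le_pos; lra).
    nra. }
  assert (hnd : NoDup (map sx l)).
  { clear hd. induction l as [|v l IH]; simpl; [constructor|].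
    inversion_clear hF' as [|? ? hv hF]. inversion_clear hP' as [|? ? hvd hP].
    constructor; [|auto]. rewrite in_map_iff. intros [w [hw hin]].
    rewrite Forall_forall in hF, hvd.
    apply (in_sextant_separated rho (sx v) e v w); auto.
    - apply hsx.
    - rewrite <- hw. apply hsx. }
  assert (hincl : incl (map sx l) (seq 1 4)).
  { intros n hn. rewrite in_map_iff in hn. destruct hn as [v [hn hv]].
    rewrite Forall_forall in hF', hd. apply in_seq.
    destruct (hsx v) as [h6 hs]. rewrite hn in h6, hs.
    assert (n <> 0)%nat.
    { intros ->. apply (in_sextant_separated rho 0 e e v); auto; simpl; lra. }
    assert (n <> 5)%nat.
    { intros ->. apply (in_sextant_separated rho 5 e e v); auto; simpl; lra. }
    lia. }
  pose proof (NoDup_incl_length hnd hincl) as h. rewrite length_map, length_seq in h.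
  simpl; lia.
Qed.

(** * Sums of lattice points that are even *)

(* The last clause is the parallelogram identity for the half-sums
   [(i + j - l) / 2] and [(i + l - j) / 2], both of square norm at least [rho]. *)
Definition halving (rho : R) (i j l s : R * R) : Prop :=
  2 * fst s = fst j + fst l - fst i /\ 2 * snd s = snd j + snd l - snd i /\
  nsq s < nsq i /\ 4 * rho <= nsq i + nsq (vsub j l).

Lemma halving_sym (rho : R) (i j l s : R * R) :
  halving rho i j l s -> halving rho i l j s.
Proof. unfold halving, nsq, vsub; simpl. intros (h1 & h2 & h3 & h4). repeat split; lra. Qed.

(** Combining the two linear relations expresses some difference through other vectors. In each of
    the nine cases this violates an upper bound [4 * rho] on a difference, a separation, or the
    order of two norms. *)
Lemma halvings_absurd_aux (rho : R) (m a b c d : R * R) :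
  (forall v, In v [m; a; b; c; d] -> nsq v < rho) ->
  ForallOrdPairs (fun v w => rho <= nsq (vsub v w)) [m; a; b; c; d] ->
  halving rho m a b c \/ halving rho a m b c \/ halving rho b m a c ->
  halving rho m c d a \/ halving rho c m d a \/ halving rho d m c a -> False.
Proof.
  intros hn hs h1 h2.
  assert (hm := hn m ltac:(simpl; tauto)). assert (ha := hn a ltac:(simpl; tauto)).
  assert (hb := hn b ltac:(simpl; tauto)). assert (hc := hn c ltac:(simpl; tauto)).
  assert (hd := hn d ltac:(simpl; tauto)). clear hn.
  repeat match goal with
    | h : ForallOrdPairs _ _ |- _ => inversion_clear h
    | h : Forall _ _ |- _ => inversion_clear h
  end.
  assert (hmb := nsq_sub_lt _ _ _ hm hb). assert (hmd := nsq_sub_lt _ _ _ hm hd).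
  assert (hbd := nsq_sub_lt _ _ _ hb hd).
  destruct m as [m1 m2], a as [a1 a2], b as [b1 b2], c as [c1 c2], d as [d1 d2].
  unfold halving, nsq, vsub in *; simpl fst in *; simpl snd in *.
  destruct h1 as [h1|[h1|h1]], h2 as [h2|[h2|h2]];
    destruct h1 as (e1 & e2 & e3 & e4); destruct h2 as (f1 & f2 & f3 & f4).
  (* A difference below [4 * rho] in square norm would be three times a difference of at least
     [rho]. *)
  - replace (b1 - d1) with (3 * (c1 - a1)) in hbd by lra.
    replace (b2 - d2) with (3 * (c2 - a2)) in hbd by lra. nra.
  - replace (m1 - d1) with (2 * b1 - 5 * c1) in hmd by lra.
    replace (m2 - d2) with (2 * b2 - 5 * c2) in hmd by lra. nra.
  (* The square norm of [c + d] would exceed [3 * rho], against the parallelogram identity for the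
     separated pair [c], [d]. *)
  - replace (a1 - b1) with (- (c1 + d1)) in e4 by lra.
    replace (a2 - b2) with (- (c2 + d2)) in e4 by lra. nra.
  - replace (m1 - b1) with (2 * d1 - 5 * a1) in hmb by lra.
    replace (m2 - b2) with (2 * d2 - 5 * a2) in hmb by lra. nra.
  (* Here [c] is shorter than [a] and [a] is shorter than [c]. *)
  - lra.
  - replace (m1 - b1) with (2 * (m1 - c1) - a1) in hmb by lra.
    replace (m2 - b2) with (2 * (m2 - c2) - a2) in hmb by lra.
    pose proof (pow2_ge_0 (m1 - c1 - 2 * a1)). pose proof (pow2_ge_0 (m2 - c2 - 2 * a2)). nra.
  - replace (c1 - d1) with (- (a1 + b1)) in f4 by lra.
    replace (c2 - d2) with (- (a2 + b2)) in f4 by lra. nra.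
  - replace (m1 - d1) with (2 * (m1 - a1) - c1) in hmd by lra.
    replace (m2 - d2) with (2 * (m2 - a2) - c2) in hmd by lra.
    pose proof (pow2_ge_0 (m1 - a1 - 2 * c1)). pose proof (pow2_ge_0 (m2 - a2 - 2 * c2)). nra.
  - replace (b1 - d1) with (3 * (a1 - c1)) in hbd by lra.
    replace (b2 - d2) with (3 * (a2 - c2)) in hbd by lra. nra.
Qed.

Ltac split_pairs :=
  repeat (apply FOP_cons || apply FOP_nil || apply Forall_cons || apply Forall_nil).

(** Exchanging [a] with [b] and [c] with [d] reduces the four choices of half-sums to one. *)
Lemma halvings_absurd (rho : R) (m a b c d : R * R) :
  (forall v, In v [m; a; b; c; d] -> nsq v < rho) ->
  ForallOrdPairs (fun v w => rho <= nsq (vsub v w)) [m; a; b; c; d] ->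
  (exists s, (s = c \/ s = d) /\
     (halving rho m a b s \/ halving rho a m b s \/ halving rho b m a s)) ->
  (exists s, (s = a \/ s = b) /\
     (halving rho m c d s \/ halving rho c m d s \/ halving rho d m c s)) -> False.
Proof.
  intros hn hs (s & hsc & h1) (s' & hsa & h2).
  assert (flip : forall i j l t, halving rho i j l t -> halving rho i l j t)
    by (intros; apply halving_sym; assumption).
  repeat match goal with
    | h : ForallOrdPairs _ _ |- _ => inversion_clear h
    | h : Forall _ _ |- _ => inversion_clear h
  end.
  destruct hsc; subst s; destruct hsa; subst s'.
  - apply (halvings_absurd_aux rho m a b c d); auto. split_pairs; auto.
  - apply (halvings_absurd_aux rho m b a c d); try tauto.
    + intros v hv; apply hn; simpl in *; tauto.
    + split_pairs; auto; rewrite nsq_vsubC; auto.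
    + destruct h1 as [h1|[h1|h1]]; auto.
  - apply (halvings_absurd_aux rho m a b d c); try tauto.
    + intros v hv; apply hn; simpl in *; tauto.
    + split_pairs; auto; rewrite nsq_vsubC; auto.
    + destruct h2 as [h2|[h2|h2]]; auto.
  - apply (halvings_absurd_aux rho m b a d c); try tauto.
    + intros v hv; apply hn; simpl in *; tauto.
    + split_pairs; auto; rewrite nsq_vsubC; auto.
    + destruct h1 as [h1|[h1|h1]]; auto.
    + destruct h2 as [h2|[h2|h2]]; auto.
Qed.

(** * Classes of integer triples modulo 2 and the Fano plane *)

Definition parity (w : Z * Z * Z) : bool * bool * bool :=
  (Z.odd (fst (fst w)), Z.odd (snd (fst w)), Z.odd (snd w)).

Definition pxor (p q : bool * bool * bool) : bool * bool * bool :=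
  (xorb (fst (fst p)) (fst (fst q)), xorb (snd (fst p)) (snd (fst q)), xorb (snd p) (snd q)).

Definition peqb (p q : bool * bool * bool) : bool :=
  Bool.eqb (fst (fst p)) (fst (fst q)) && Bool.eqb (snd (fst p)) (snd (fst q))
  && Bool.eqb (snd p) (snd q).

Lemma peqb_eq (p q : bool * bool * bool) : peqb p q = true <-> p = q.
Proof.
  destruct p as [[[] []] []], q as [[[] []] []]; simpl; split; intro h;
    reflexivity || discriminate h.
Qed.

Definition nonzero_parities : list (bool * bool * bool) :=
  [(true, false, false); (false, true, false); (false, false, true); (true, true, false);
   (true, false, true); (false, true, true); (true, true, true)].

Definition zero_sum (p q r : bool * bool * bool) : bool :=
  peqb (pxor p (pxor q r)) (false, false, false).

(* The indices of the two zero-sum triples [m, a, b] and [m, c, d]. *)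
Definition splittings : list (nat * (nat * nat) * (nat * nat)) :=
  flat_map (fun t => let '(m, (p, q, r, s)) := t in
     [(m, (p, q), (r, s)); (m, (p, r), (q, s)); (m, (p, s), (q, r))])
    [(0, (1, 2, 3, 4)); (1, (0, 2, 3, 4)); (2, (0, 1, 3, 4));
     (3, (0, 1, 2, 4)); (4, (0, 1, 2, 3))]%nat.

Definition splits (l : list (bool * bool * bool)) : bool :=
  existsb (fun t => let '(m, (a, b), (c, d)) := t in
     let x n := nth n l (false, false, false) in
     (zero_sum (x m) (x a) (x b) && zero_sum (x m) (x c) (x d))%bool) splittings.

Fixpoint distinctb (l : list (bool * bool * bool)) : bool :=
  match l with
  | [] => true
  | p :: l => (negb (existsb (peqb p) l) && distinctb l)%bool
  end.

Lemma splits_all :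
  forallb (fun p1 => forallb (fun p2 => forallb (fun p3 => forallb (fun p4 =>
    forallb (fun p5 => let l := [p1; p2; p3; p4; p5] in implb (distinctb l) (splits l))
    nonzero_parities) nonzero_parities) nonzero_parities) nonzero_parities)
    nonzero_parities = true.
Proof. vm_compute. reflexivity. Qed.

Lemma distinctb_NoDup (l : list (bool * bool * bool)) : NoDup l -> distinctb l = true.
Proof.
  induction 1 as [|p l hp _ IH]; simpl; [reflexivity|].
  rewrite IH, Bool.andb_true_r. apply Bool.negb_true_iff, Bool.not_true_iff_false.
  rewrite existsb_exists. intros (q & hq & e). apply peqb_eq in e. congruence.
Qed.

Lemma nonzero_paritiesP (p : bool * bool * bool) :
  p <> (false, false, false) -> In p nonzero_parities.
Proof. destruct p as [[[] []] []]; simpl; intro h; tauto. Qed.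

(* A set of five points of the Fano plane contains two of its lines. *)
Lemma two_zero_sums (X : Type) (par : X -> bool * bool * bool) (x1 x2 x3 x4 x5 : X) :
  NoDup (map par [x1; x2; x3; x4; x5]) ->
  (forall x, In x [x1; x2; x3; x4; x5] -> par x <> (false, false, false)) ->
  exists m a b c d,
    pxor (par m) (pxor (par a) (par b)) = (false, false, false) /\
    pxor (par m) (pxor (par c) (par d)) = (false, false, false) /\
    incl [m; a; b; c; d] [x1; x2; x3; x4; x5] /\ NoDup [m; a; b; c; d].
Proof.
  intros hnd hnz. pose proof splits_all as h.
  rewrite forallb_forall in h. specialize (h _ (nonzero_paritiesP _ (hnz x1 ltac:(simpl; tauto)))).
  rewrite forallb_forall in h. specialize (h _ (nonzero_paritiesP _ (hnz x2 ltac:(simpl; tauto)))).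
  rewrite forallb_forall in h. specialize (h _ (nonzero_paritiesP _ (hnz x3 ltac:(simpl; tauto)))).
  rewrite forallb_forall in h. specialize (h _ (nonzero_paritiesP _ (hnz x4 ltac:(simpl; tauto)))).
  rewrite forallb_forall in h. specialize (h _ (nonzero_paritiesP _ (hnz x5 ltac:(simpl; tauto)))).
  cbv zeta in h. pose proof (distinctb_NoDup _ hnd) as hd. cbn [map] in hd.
  rewrite hd in h. cbn [implb] in h.
  unfold splits in h. rewrite existsb_exists in h. destruct h as (t & ht & h).
  apply NoDup_map_inv in hnd.
  simpl in hnd.
  repeat match goal with h : NoDup (_ :: _) |- _ => inversion_clear h end.
  simpl in ht.
  repeat (destruct ht as [<- | ht]; [
    cbn [nth] in h; apply andb_prop in h; destruct h as [h1 h2];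
    apply peqb_eq in h1; apply peqb_eq in h2;
    do 5 eexists; split; [exact h1|]; split; [exact h2|]; split;
    [ intros x hin; simpl in *; tauto
    | simpl in *; repeat constructor; simpl; intuition congruence ] | ]).
  destruct ht.
Qed.

(** * Lattice points of the extended lattice *)

(* The planar part of a point of a lattice of R^3; [k] is the height of the
   point, and [u] is the vector alpha of the problem or its opposite. *)
Definition emb (u v1 v2 : R * R) (w : Z * Z * Z) : R * R :=
  let '(i, j, k) := w in
  (IZR k * fst u + IZR i * fst v1 + IZR j * fst v2,
   IZR k * snd u + IZR i * snd v1 + IZR j * snd v2).

Definition ht (w : Z * Z * Z) : Z := snd w.

Definition padd (w z : Z * Z * Z) : Z * Z * Z :=
  (fst (fst w) + fst (fst z), snd (fst w) + snd (fst z), snd w + snd z)%Z.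
Definition popp (w : Z * Z * Z) : Z * Z * Z :=
  (- fst (fst w), - snd (fst w), - snd w)%Z.

Lemma emb_add u v1 v2 w z :
  emb u v1 v2 (padd w z) = vadd (emb u v1 v2 w) (emb u v1 v2 z).
Proof.
  destruct w as [[i j] k], z as [[i' j'] k']; unfold padd, vadd; simpl.
  rewrite !plus_IZR; f_equal; ring.
Qed.

Lemma emb_opp u v1 v2 w : emb u v1 v2 (popp w) = vopp (emb u v1 v2 w).
Proof.
  destruct w as [[i j] k]; unfold popp, vopp; simpl.
  rewrite !opp_IZR; f_equal; ring.
Qed.

Definition peven (w : Z * Z * Z) : Prop := exists z, w = padd z z.

Lemma peven_parity w : parity w = (false, false, false) -> peven w.
Proof.
  destruct w as [[i j] k]; unfold parity; simpl; intro h; injection h as h1 h2 h3.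
  assert (hz : forall n, Z.odd n = false -> exists m, n = (m + m)%Z).
  { intros n hn. rewrite <- Z.negb_even in hn. apply Bool.negb_false_iff in hn.
    apply Z.even_spec in hn. destruct hn as [m ->]. exists m. lia. }
  destruct (hz _ h1) as [i' ->], (hz _ h2) as [j' ->], (hz _ h3) as [k' ->].
  exists (i', j', k'). reflexivity.
Qed.

Lemma parity_padd w z : parity (padd w z) = pxor (parity w) (parity z).
Proof. unfold parity, pxor, padd; simpl. rewrite !Z.odd_add. reflexivity. Qed.

Lemma parity_popp w : parity (popp w) = parity w.
Proof. unfold parity, popp; simpl. rewrite !Z.odd_opp. reflexivity. Qed.

(** Subtracting [2z] reverses the sign of a summand [z], so every signed sum of a triple with even
    sum can be halved. *)
Lemma peven_padd2 w z : peven w -> peven (padd w (popp (padd z z))).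
Proof.
  intros [t ->]. exists (padd t (popp z)). unfold padd, popp; simpl.
  f_equal; [f_equal|]; lia.
Qed.

Lemma peven_emb u v1 v2 w : peven w -> exists z, (ht w = 2 * ht z)%Z /\
  fst (emb u v1 v2 w) = 2 * fst (emb u v1 v2 z) /\
  snd (emb u v1 v2 w) = 2 * snd (emb u v1 v2 z).
Proof.
  intros [z ->]. exists z. rewrite emb_add.
  unfold vadd, ht, padd; cbn [fst snd].
  split; [lia|split; ring].
Qed.

(** * The full circle: at most four outer points *)

Section FullCircle.

Context (u v1 v2 : R * R) (a b : Z) (rho : R).
Context (hab : (0 <= b <= a)%Z).
Context (hwin : forall w, (- a <= ht w <= a)%Z -> 0 < nsq (emb u v1 v2 w) ->
          rho <= nsq (emb u v1 v2 w)).

Local Notation V := (emb u v1 v2).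

Definition outer (w : Z * Z * Z) : Prop :=
  (a + 1 <= ht w <= a + b)%Z /\ 0 < nsq (V w) < rho.

Lemma outer_sep w z : outer w -> outer z -> V w <> V z -> rho <= nsq (vsub (V w) (V z)).
Proof.
  intros [hw _] [hz _] hne. rewrite <- vadd_vopp, <- emb_opp, <- emb_add.
  apply hwin; [unfold ht, padd, popp in *; cbn [fst snd]; lia|].
  rewrite emb_add, emb_opp, vadd_vopp. apply nsq_vsub_gt0; assumption.
Qed.

(** Since [i] is lowest, the half-sums [z1 = (i + j - l) / 2] and [z2 = (i + l - j) / 2] have
    heights within the window, hence are long. This forces [y = (j + l - i) / 2] to be shorter than
    [i], hence an outer point itself, and six separated vectors cannot exist. *)
Lemma outer_halving i j l c d :
  Forall outer [i; j; l; c; d] -> NoDup (map V [i; j; l; c; d]) ->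
  (ht i <= ht j)%Z -> (ht i <= ht l)%Z -> peven (padd i (padd j l)) ->
  exists s, (s = V c \/ s = V d) /\ halving rho (V i) (V j) (V l) s.
Proof.
  intros hF hnd hij hil hev.
  assert (hsep : forall x y, In x [i; j; l; c; d] -> In y [i; j; l; c; d] ->
            V x <> V y -> rho <= nsq (vsub (V x) (V y))).
  { intros x y hx hy. rewrite Forall_forall in hF. apply outer_sep; auto. }
  assert (hrow : forall x, In x [i; j; l; c; d] -> outer x) by (apply Forall_forall; auto).
  clear hF. rename hrow into hF.
  assert (hi := hF i ltac:(simpl; tauto)). assert (hj := hF j ltac:(simpl; tauto)).
  assert (hl := hF l ltac:(simpl; tauto)).
  assert (nij : V i <> V j) by (simpl in hnd; inversion_clear hnd; simpl in *; intuition).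
  assert (nil : V i <> V l) by (simpl in hnd; inversion_clear hnd; simpl in *; intuition).
  assert (sij := hsep i j ltac:(simpl; tauto) ltac:(simpl; tauto) nij).
  assert (sil := hsep i l ltac:(simpl; tauto) ltac:(simpl; tauto) nil).
  assert (e1 := peven_padd2 _ l hev). assert (e2 := peven_padd2 _ j hev).
  assert (e3 := peven_padd2 _ i hev).
  apply (peven_emb u v1 v2) in e1. apply (peven_emb u v1 v2) in e2.
  apply (peven_emb u v1 v2) in e3.
  destruct e1 as (z1 & k1 & x1 & y1). destruct e2 as (z2 & k2 & x2 & y2).
  destruct e3 as (y & k3 & x3 & y3).
  rewrite !emb_add, !emb_opp, !emb_add in x1, y1, x2, y2, x3, y3.
  unfold ht, padd, popp in k1, k2, k3. cbn [fst snd] in k1, k2, k3.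
  destruct hi as [ki ni], hj as [kj nj], hl as [kl nl]. unfold ht in *.
  assert (w1 := hwin z1 ltac:(unfold ht; lia)). assert (w2 := hwin z2 ltac:(unfold ht; lia)).
  assert (w3 := hwin y).
  assert (oy : forall s, In s [i; j; l; c; d] -> (a + 1 <= ht y <= a + b)%Z ->
             0 < nsq (V y) < rho -> V y <> V s -> rho <= nsq (vsub (V y) (V s))).
  { intros s hs h1 h2. apply outer_sep; [split; auto | auto]. }
  assert (H : 0 < nsq (V y) /\ nsq (V y) < nsq (V i) /\
              4 * rho <= nsq (V i) + nsq (vsub (V j) (V l)) /\
              V y <> V i /\ V y <> V j /\ V y <> V l).
  { clear oy hsep hF hnd hev hwin.
    unfold vadd, vopp in *. cbn [fst snd] in *.
    destruct (V i) as [i1 i2], (V j) as [j1 j2], (V l) as [l1 l2], (V z1) as [p1 p2],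
      (V z2) as [q1 q2], (V y) as [t1 t2]. unfold nsq, vsub in *. cbn [fst snd] in *.
    assert (a1 : p1 = (i1 + j1 - l1) / 2) by lra. assert (a2 : p2 = (i2 + j2 - l2) / 2) by lra.
    assert (b1 : q1 = (i1 + l1 - j1) / 2) by lra. assert (b2 : q2 = (i2 + l2 - j2) / 2) by lra.
    assert (c1 : t1 = (j1 + l1 - i1) / 2) by lra. assert (c2 : t2 = (j2 + l2 - i2) / 2) by lra.
    clear x1 y1 x2 y2 x3 y3. subst p1 p2 q1 q2.
    (* A vanishing half-sum would give [i - l = - j], too short for two separated vectors. *)
    assert (r1 : 0 < ((i1 + j1 - l1) / 2) ^ 2 + ((i2 + j2 - l2) / 2) ^ 2).
    { apply Rnot_le_lt. intro h.
      apply sum_sq_le0 in h.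
      replace (i1 - l1) with (- j1) in sil by lra. replace (i2 - l2) with (- j2) in sil by lra.
      nra. }
    assert (r2 : 0 < ((i1 + l1 - j1) / 2) ^ 2 + ((i2 + l2 - j2) / 2) ^ 2).
    { apply Rnot_le_lt. intro h.
      apply sum_sq_le0 in h.
      replace (i1 - j1) with (- l1) in sij by lra. replace (i2 - j2) with (- l2) in sij by lra.
      nra. }
    specialize (w1 r1). specialize (w2 r2).
    (* The parallelogram identity for [z1] and [z2] gives [D]; the one for [j] and [l] then gives
       [S]. *)
    assert (D : 4 * rho <= i1 ^ 2 + i2 ^ 2 + ((j1 - l1) ^ 2 + (j2 - l2) ^ 2)) by nra.
    assert (S : (j1 + l1) ^ 2 + (j2 + l2) ^ 2 < i1 ^ 2 + i2 ^ 2) by nra.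
    assert (ny : t1 ^ 2 + t2 ^ 2 < i1 ^ 2 + i2 ^ 2).
    { subst t1 t2. pose proof (pow2_ge_0 (j1 + l1 + i1)). pose proof (pow2_ge_0 (j2 + l2 + i2)). nra. }
    split; [|split; [exact ny|split; [exact D|]]].
    - apply Rnot_le_lt. intro h.
      apply sum_sq_le0 in h.
      replace (i1 - j1) with l1 in sij by lra. replace (i2 - j2) with l2 in sij by lra. nra.
    - split; [|split]; intro e; injection e as -> ->.
      + lra.
      + replace (i1 - l1) with (- j1) in sil by lra. replace (i2 - l2) with (- j2) in sil by lra.
        nra.
      + replace (i1 - j1) with (- l1) in sij by lra. replace (i2 - j2) with (- l2) in sij by lra.
        nra. }
  destruct H as (p0 & p1 & p2 & p3 & p4 & p5).
  (* A nonzero vector as short as [V y] cannot have its height in the window, so [y] lies above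
     [a]. *)
  assert (ky : (a + 1 <= ht y <= a + b)%Z).
  { split; [|unfold ht; lia].
    destruct (Z_le_gt_dec (ht y) a) as [h|h]; [|unfold ht in *; lia]. exfalso.
    assert (rho <= nsq (V y)) by (apply w3; [unfold ht in *; lia | assumption]). lra. }
  assert (hs : V y = V c \/ V y = V d).
  { apply NNPP. intro h. apply not_or_and in h. destruct h as [h6 h7].
    assert (h := separated_length rho (V y :: map V [i; j; l; c; d])).
    assert (hlen : (length (V y :: map V [i; j; l; c; d]) = 6)%nat) by reflexivity.
    rewrite hlen in h. enough (6 <= 5)%nat by lia. apply h. clear h hlen. split.
    - constructor; [lra|]. apply Forall_forall. intros v hv. apply in_map_iff in hv.
      destruct hv as (x & <- & hx). apply hF in hx. apply hx.
    - constructor.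
      + apply Forall_forall. intros v hv. apply in_map_iff in hv.
        destruct hv as (x & <- & hx). apply oy; auto; [lra|].
        simpl in hx. intuition congruence.
      + clear oy. simpl in hnd.
        repeat match goal with h : NoDup (_ :: _) |- _ => inversion_clear h end.
        simpl. split_pairs; apply hsep; simpl in *; intuition. }
  exists (V y). split; [exact hs|]. unfold vadd, vopp in x3, y3. cbn [fst snd] in x3, y3.
  repeat split; auto; lra.
Qed.

(** Five outer points would have distinct nonzero parities, hence two even triples sharing one
    point. The half-sum of each triple is a point of the other one, which [halvings_absurd]
    excludes. *)
Lemma outer_length_le4 (l : list (Z * Z * Z)) :
  Forall outer l -> NoDup (map V l) -> (length l <= 4)%nat.
Proof.
  intros hF hnd. destruct l as [|x1 [|x2 [|x3 [|x4 [|x5 l]]]]]; try (simpl; lia). exfalso.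
  assert (hF' : forall x, In x [x1; x2; x3; x4; x5] -> outer x).
  { intros x hx. rewrite Forall_forall in hF. apply hF. simpl in *. tauto. }
  assert (hnd' : NoDup (map V [x1; x2; x3; x4; x5])).
  { change (NoDup (map V ([x1; x2; x3; x4; x5] ++ l))) in hnd. rewrite map_app in hnd.
    apply NoDup_app_remove_r in hnd. exact hnd. }
  clear hF hnd. remember [x1; x2; x3; x4; x5] as L eqn:eL.
  assert (hinj : forall x y, In x L -> In y L -> V x = V y -> x = y).
  { clear eL hF'. induction L as [|t L IH]; [intros ? ? []|].
    simpl in hnd'. inversion_clear hnd' as [|? ? ht' hL].
    intros x y [<-|hx] [<-|hy] e; auto.
    - exfalso. apply ht'. rewrite e. apply in_map. assumption.
    - exfalso. apply ht'. rewrite <- e. apply in_map. assumption. }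
  (* Half the difference of two points of equal parity would be a nonzero vector of the window
     shorter than [rho] allows. *)
  assert (hpar : forall x y, In x L -> In y L -> parity x = parity y -> x = y).
  { intros x y hx hy e. apply NNPP. intro hne.
    assert (hV : V x <> V y) by auto.
    assert (hev : peven (padd x (popp y))).
    { apply peven_parity. rewrite parity_padd, parity_popp, e.
      unfold pxor; simpl; rewrite !Bool.xorb_nilpotent. reflexivity. }
    apply (peven_emb u v1 v2) in hev. destruct hev as (z & k & z1 & z2).
    rewrite emb_add, emb_opp, vadd_vopp in z1, z2.
    destruct (hF' x hx) as [kx nx], (hF' y hy) as [ky ny].
    assert (hz := hwin z). unfold ht, padd, popp in *. cbn [fst snd] in k.
    assert (hlt := nsq_sub_lt rho (V x) (V y) ltac:(lra) ltac:(lra)).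
    assert (hgt := nsq_vsub_gt0 _ _ hV).
    assert (e4 : nsq (vsub (V x) (V y)) = 4 * nsq (V z)) by (unfold nsq; rewrite z1, z2; ring).
    rewrite e4 in *. assert (rho <= nsq (V z)) by (apply hz; [lia | lra]). lra. }
  (* Half of a point of even parity would lie in the window, since [a + b <= 2 * a], and be too
     short. *)
  assert (hnz : forall x, In x L -> parity x <> (false, false, false)).
  { intros x hx e. apply peven_parity in e. apply (peven_emb u v1 v2) in e.
    destruct e as (z & k & z1 & z2). destruct (hF' x hx) as [kx nx].
    assert (hz := hwin z).
    assert (e4 : nsq (V x) = 4 * nsq (V z)) by (unfold nsq; rewrite z1, z2; ring).
    rewrite e4 in nx. assert (rho <= nsq (V z)) by (apply hz; [unfold ht in *; lia | lra]). lra. }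
  assert (hndL := NoDup_map_inv _ _ hnd').
  assert (hndp : NoDup (map parity L)).
  { apply NoDup_map_NoDup_ForallPairs; [intros x y hx hy; auto | auto]. }
  subst L.
  destruct (two_zero_sums _ parity _ _ _ _ _ hndp hnz)
    as (m & p & q & r & s & h1 & h2 & hin & hnd).
  assert (hO : forall x, In x [m; p; q; r; s] -> outer x) by auto.
  assert (hndV : NoDup (map V [m; p; q; r; s])).
  { apply NoDup_map_NoDup_ForallPairs; [intros x y hx hy; auto | auto]. }
  assert (E1 : peven (padd m (padd p q))) by (apply peven_parity; rewrite !parity_padd; auto).
  assert (E2 : peven (padd m (padd r s))) by (apply peven_parity; rewrite !parity_padd; auto).
  (* The lowest point of the triple takes the role of [i] in [outer_halving]. *)
  assert (key : forall m p q r s,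
     (forall x, In x [m; p; q; r; s] -> outer x) -> NoDup (map V [m; p; q; r; s]) ->
     peven (padd m (padd p q)) ->
     exists t, (t = V r \/ t = V s) /\ (halving rho (V m) (V p) (V q) t \/
        halving rho (V p) (V m) (V q) t \/ halving rho (V q) (V m) (V p) t)).
  { clear -hab hwin. intros m p q r s hO hnd he.
    assert (comm : padd m (padd p q) = padd p (padd m q) /\
                   padd m (padd p q) = padd q (padd m p))
      by (unfold padd; simpl; split; (f_equal; [f_equal|]); lia).
    assert (hcase : ((ht m <= ht p /\ ht m <= ht q) \/ (ht p <= ht m /\ ht p <= ht q) \/
                    (ht q <= ht m /\ ht q <= ht p))%Z) by lia.
    simpl in hnd.
    repeat match goal with h : NoDup (_ :: _) |- _ => inversion_clear h end.
    destruct hcase as [[k1 k2]|[[k1 k2]|[k1 k2]]].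
    - destruct (outer_halving m p q r s) as (t & h1 & h2); auto.
      + apply Forall_forall; auto.
      + simpl. repeat constructor; simpl in *; intuition.
      + exists t; auto.
    - destruct (outer_halving p m q r s) as (t & h1 & h2); auto.
      + apply Forall_forall; intros x hx; apply hO; simpl in *; tauto.
      + simpl. repeat constructor; simpl in *; intuition.
      + destruct comm as [<- _]; auto.
      + exists t; auto.
    - destruct (outer_halving q m p r s) as (t & h1 & h2); auto.
      + apply Forall_forall; intros x hx; apply hO; simpl in *; tauto.
      + simpl. repeat constructor; simpl in *; intuition.
      + destruct comm as [_ <-]; auto.
      + exists t; auto. }
  apply (halvings_absurd rho (V m) (V p) (V q) (V r) (V s)).
  - intros v hv. change (In v (map V [m; p; q; r; s])) in hv. apply in_map_iff in hv.
    destruct hv as (x & <- & hx). apply hO in hx. apply hx.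
  - clear key. simpl in hndV.
    repeat match goal with h : NoDup (_ :: _) |- _ => inversion_clear h end.
    split_pairs; (apply outer_sep; [apply hO; simpl; tauto | apply hO; simpl; tauto |
      simpl in *; intuition]).
  - apply key; auto.
  - apply key; auto.
    + intros x hx; apply hO; simpl in *; tauto.
    + clear key. simpl in hndV.
      repeat match goal with h : NoDup (_ :: _) |- _ => inversion_clear h end.
      simpl. repeat constructor; simpl in *; intuition.
Qed.

End FullCircle.

(** * Cones *)

Lemma in_cone_nsq th0 tau lc v : in_cone th0 tau lc v -> 0 < nsq v.
Proof.
  intros (s & t & hs & _ & ->). unfold nsq; cbn [fst snd].
  pose proof (sin2_cos2 t) as h. unfold Rsqr in h.
  replace ((s * cos t) ^ 2 + (s * sin t) ^ 2)
    with (s * s * (sin t * sin t + cos t * cos t)) by ring.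
  rewrite h, Rmult_1_r. apply Rmult_lt_0_compat; assumption.
Qed.

Lemma shift_angle (A t : R) (lc : bool) : exists t',
  (if lc then A <= t' < A + 2 * PI else A < t' <= A + 2 * PI) /\
  cos t' = cos t /\ sin t' = sin t.
Proof.
  assert (hper : forall k : Z, cos (t + 2 * IZR k * PI) = cos t /\
                               sin (t + 2 * IZR k * PI) = sin t).
  { intro k. destruct (Z_le_gt_dec 0 k) as [h|h].
    - rewrite <- (Z2Nat.id k h), <- INR_IZR_INZ. split; [apply cos_period | apply sin_period].
    - rewrite <- (cos_period _ (Z.to_nat (- k))), <- (sin_period _ (Z.to_nat (- k))).
      rewrite INR_IZR_INZ, Z2Nat.id by lia. rewrite opp_IZR. split; f_equal; ring. }
  pose proof PI_RGT_0 as hPI.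
  destruct lc.
  - destruct (base_Int_part ((t - A) / (2 * PI))) as [h1 h2].
    set (k := Int_part ((t - A) / (2 * PI))) in *.
    exists (t + 2 * IZR (- k) * PI). split; [|apply hper]. rewrite opp_IZR.
    assert (e : (t - A) / (2 * PI) * (2 * PI) = t - A) by (field; lra).
    assert (IZR k * (2 * PI) <= t - A) by (rewrite <- e; apply Rmult_le_compat_r; lra).
    assert (t - A < (IZR k + 1) * (2 * PI)) by (rewrite <- e; apply Rmult_lt_compat_r; lra).
    lra.
  (* Taking the floor of the opposite quotient and adding one turn makes the interval open on the
     left and closed on the right. *)
  - destruct (base_Int_part ((A - t) / (2 * PI))) as [h1 h2].
    set (k := Int_part ((A - t) / (2 * PI))) in *.
    exists (t + 2 * IZR (k + 1) * PI). split; [|apply hper]. rewrite plus_IZR.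
    assert (e : (A - t) / (2 * PI) * (2 * PI) = A - t) by (field; lra).
    assert (IZR k * (2 * PI) <= A - t) by (rewrite <- e; apply Rmult_le_compat_r; lra).
    assert (A - t < (IZR k + 1) * (2 * PI)) by (rewrite <- e; apply Rmult_lt_compat_r; lra).
    lra.
Qed.

Lemma in_cone_full A lc v : 0 < nsq v -> in_cone A (2 * PI) lc v.
Proof.
  intro hv. set (s := sqrt (nsq v)).
  assert (hs : 0 < s) by (apply sqrt_lt_R0; exact hv).
  assert (hss : s * s = nsq v) by (apply sqrt_sqrt; lra).
  assert (H : exists t, fst v = s * cos t /\ snd v = s * sin t).
  { assert (hx : (fst v / s)² + (snd v / s)² = 1).
    { unfold Rsqr. replace (fst v / s * (fst v / s) + snd v / s * (snd v / s))
        with (nsq v / (s * s)) by (unfold nsq; field; lra). rewrite hss. field. lra. }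
    assert (hb : -1 <= fst v / s <= 1).
    { pose proof (Rle_0_sqr (snd v / s)). unfold Rsqr in *. split; nra. }
    assert (ha : Rabs (snd v / s) = sin (acos (fst v / s))).
    { rewrite sin_acos by exact hb. rewrite <- sqrt_Rsqr_abs. f_equal. lra. }
    destruct (Rle_lt_dec 0 (snd v / s)) as [h|h].
    - exists (acos (fst v / s)). rewrite cos_acos, <- ha, Rabs_pos_eq by lra.
      split; field; lra.
    - exists (- acos (fst v / s)).
      rewrite cos_neg, sin_neg, cos_acos, <- ha, Rabs_left by lra.
      split; field; lra. }
  destruct H as (t & e1 & e2). destruct (shift_angle A t lc) as (t' & ht' & c & d).
  exists s, t'. split; [exact hs|split; [exact ht'|]].
  rewrite c, d, <- e1, <- e2. destruct v; reflexivity.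
Qed.

Lemma cone_or_gap th0 tau lc v : 0 <= tau <= 2 * PI -> 0 < nsq v ->
  in_cone th0 tau lc v \/ in_cone (th0 + tau) (2 * PI - tau) lc v.
Proof.
  intros htau hv. destruct (in_cone_full th0 lc v hv) as (s & t & hs & ht & e).
  destruct lc.
  - destruct (Rlt_le_dec t (th0 + tau)); [left|right]; exists s, t; repeat split; auto; lra.
  - destruct (Rle_lt_dec t (th0 + tau)); [left|right]; exists s, t; repeat split; auto; lra.
Qed.

(** The gap has angle less than PI, so a half-turn carries it into the cone. *)
Lemma gap_vopp th0 tau lc v : PI < tau ->
  in_cone (th0 + tau) (2 * PI - tau) lc v -> in_cone th0 tau lc (vopp v).
Proof.
  intros htau (s & t & hs & ht & ->). exists s, (t - PI).
  assert (hc : cos (t - PI) = - cos t /\ sin (t - PI) = - sin t).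
  { rewrite cos_minus, sin_minus, cos_PI, sin_PI. lra. }
  destruct hc as [hc hd]. split; [exact hs|split].
  - destruct lc; lra.
  - unfold vopp; cbn [fst snd]. rewrite hc, hd. f_equal; ring.
Qed.

(* The gap is convex: it is cut out by the signs of the determinants with its
   two boundary directions. *)
Lemma gap_vadd th0 tau lc v w : PI < tau <= 2 * PI ->
  in_cone (th0 + tau) (2 * PI - tau) lc v -> in_cone (th0 + tau) (2 * PI - tau) lc w ->
  ~ in_cone th0 tau lc (vadd v w).
Proof.
  intros htau hv hw hvw. pose proof PI_RGT_0 as hPI.
  set (dA := fun z : R * R => cos (th0 + tau) * snd z - sin (th0 + tau) * fst z).
  set (dB := fun z : R * R => fst z * sin (th0 + 2 * PI) - snd z * cos (th0 + 2 * PI)).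
  assert (eA : forall s t, dA (s * cos t, s * sin t) = s * sin (t - (th0 + tau)))
    by (intros; unfold dA; cbn [fst snd]; rewrite sin_minus; ring).
  assert (eB : forall s t, dB (s * cos t, s * sin t) = s * sin (th0 + 2 * PI - t))
    by (intros; unfold dB; cbn [fst snd]; rewrite sin_minus; ring).
  assert (sgn : forall z, in_cone (th0 + tau) (2 * PI - tau) lc z ->
     if lc then 0 <= dA z /\ 0 < dB z else 0 < dA z /\ 0 <= dB z).
  { intros z (s & t & hs & ht & ->). rewrite eA, eB. destruct lc; split.
    - apply Rmult_le_pos; [lra | apply sin_ge_0; lra].
    - apply Rmult_lt_0_compat; [lra | apply sin_gt_0; lra].
    - apply Rmult_lt_0_compat; [lra | apply sin_gt_0; lra].
    - apply Rmult_le_pos; [lra | apply sin_ge_0; lra]. }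
  apply sgn in hv. apply sgn in hw.
  assert (aA : dA (vadd v w) = dA v + dA w) by (unfold dA, vadd; cbn [fst snd]; ring).
  assert (aB : dB (vadd v w) = dB v + dB w) by (unfold dB, vadd; cbn [fst snd]; ring).
  destruct hvw as (s & t & hs & ht & e). rewrite e, eA in aA. rewrite e, eB in aB.
  assert (e2 : sin (th0 + 2 * PI - t) = - sin (t - th0)).
  { replace (th0 + 2 * PI - t) with (th0 - t + 2 * PI) by ring. rewrite sin_plus, sin_2PI, cos_2PI.
    replace (t - th0) with (- (th0 - t)) by ring. rewrite sin_neg. ring. }
  rewrite e2 in aB.
  assert (e3 : sin (t - (th0 + tau)) = - sin (th0 + tau - t)).
  { rewrite <- sin_neg. f_equal. ring. }
  rewrite e3 in aA.
  (* The sign of [dB] puts [t] at least PI past [th0], hence less than PI before the end of the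
     cone, where the sign of [dA] is wrong. *)
  destruct lc.
  - assert (ltB : 0 < s * - sin (t - th0)) by lra.
    assert (leA : 0 <= s * - sin (th0 + tau - t)) by lra.
    assert (PI < t - th0).
    { apply Rnot_le_lt. intro h. assert (0 <= s * sin (t - th0)).
      { apply Rmult_le_pos; [lra | apply sin_ge_0; lra]. } lra. }
    assert (0 < s * sin (th0 + tau - t)).
    { apply Rmult_lt_0_compat; [lra | apply sin_gt_0; lra]. } lra.
  - assert (leB : 0 <= s * - sin (t - th0)) by lra.
    assert (ltA : 0 < s * - sin (th0 + tau - t)) by lra.
    assert (PI <= t - th0).
    { apply Rnot_lt_le. intro h. assert (0 < s * sin (t - th0)).
      { apply Rmult_lt_0_compat; [lra | apply sin_gt_0; lra]. } lra. }
    assert (0 <= s * sin (th0 + tau - t)).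
    { apply Rmult_le_pos; [lra | apply sin_ge_0; lra]. } lra.
Qed.

Lemma cos_obtuse (x : R) : 0 <= x <= PI -> cos x <= - (1 / 2) -> 2 * PI / 3 <= x.
Proof.
  intros hx hc. apply Rnot_lt_le. intro h. pose proof PI_RGT_0.
  assert (h' : cos (2 * (PI / 3)) < cos x) by (apply cos_decreasing_1; lra).
  rewrite cos_2PI3 in h'. lra.
Qed.

(* [c] is the cosine of the angle between vectors of lengths [s] and [s'], and
   the left-hand sides are the square norm of their sum. *)
Lemma cos_le_of_short_sum (s s' c : R) : 0 < s -> 0 < s' ->
  s ^ 2 + s' ^ 2 + 2 * (s * s' * c) <= s ^ 2 ->
  s ^ 2 + s' ^ 2 + 2 * (s * s' * c) <= s' ^ 2 -> c <= - (1 / 2).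
Proof.
  intros hs hs' h1 h2.
  assert (k1 : s' * (s' + 2 * (s * c)) <= 0) by nra.
  assert (k2 : s * (s + 2 * (s' * c)) <= 0) by nra.
  assert (l1 : s' + 2 * (s * c) <= 0) by nra.
  assert (l2 : s + 2 * (s' * c) <= 0) by nra.
  destruct (Rle_lt_dec s s'); nra.
Qed.

(** * Counting far points *)

Section FarPoints.

Context (u v1 v2 : R * R) (th0 tau : R) (lc : bool) (a b : Z) (rho : R).
Context (htau : PI < tau <= 2 * PI) (hab : (0 <= b <= a)%Z).

Local Notation V := (emb u v1 v2).
Local Notation cone := (in_cone th0 tau lc).
Local Notation gap := (in_cone (th0 + tau) (2 * PI - tau) lc).

Context (hwin : forall w, (- a <= ht w <= b)%Z -> cone (V w) -> rho <= nsq (V w)).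

(* Points of negative height are recorded through their opposites. *)
Definition far (w : Z * Z * Z) : Prop :=
  (b + 1 <= ht w <= a + b)%Z /\ nsq (V w) < rho /\
  ((cone (V w) /\
    forall z, (0 <= ht z <= ht w)%Z -> cone (V z) -> nsq (V w) <= nsq (V z)) \/
   ((a + 1 <= ht w)%Z /\ cone (vopp (V w)))).

Lemma far_nsq w : far w -> 0 < nsq (V w).
Proof.
  intros (_ & _ & [[h _]|[_ h]]); apply in_cone_nsq in h; [assumption|].
  rewrite nsq_vopp in h. assumption.
Qed.

(** The exceptional pairs: [vopp (V y)] is the sum of the gap vectors [vopp (V x)] and
    [vsub (V x) (V y)], and is no longer than either, so these two make an angle of at least 2 PI /
    3. *)
Definition close_pair (x y : Z * Z * Z) : Prop :=
  gap (vopp (V x)) /\ gap (vsub (V x) (V y)) /\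
  nsq (V y) <= nsq (vsub (V x) (V y)) /\ nsq (V y) < nsq (V x).

(** With [x] the lower point, the height of [x - y] lies in the window, so this short vector is in
    the gap. Its opposite is in the cone and must therefore leave the window, which makes [y] higher
    than [x] by more than [b]. *)
Lemma far_close x y : far x -> far y -> nsq (V x) <> nsq (V y) ->
  nsq (vsub (V x) (V y)) < rho -> close_pair x y \/ close_pair y x.
Proof.
  assert (key : forall x y, far x -> far y -> nsq (V x) <> nsq (V y) ->
    nsq (vsub (V x) (V y)) < rho -> (ht x <= ht y)%Z -> close_pair x y).
  { clear x y. intros x y hx hy hne hlt hle.
    assert (hx0 := far_nsq x hx).
    destruct hx as (kx & nx & tx), hy as (ky & ny & ty).
    assert (hne' : V x <> V y) by congruence.
    assert (hd0 := nsq_vsub_gt0 _ _ hne').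
    assert (exy : V (padd x (popp y)) = vsub (V x) (V y))
      by (rewrite emb_add, emb_opp; apply vadd_vopp).
    assert (eyx : V (padd y (popp x)) = vopp (vsub (V x) (V y))).
    { rewrite emb_add, emb_opp. unfold vadd, vopp, vsub; cbn [fst snd]; f_equal; ring. }
    assert (hd : gap (vsub (V x) (V y))).
    { destruct (cone_or_gap th0 tau lc (vsub (V x) (V y))) as [h|h]; auto; [lra|].
      assert (rho <= nsq (V (padd x (popp y)))).
      { apply hwin; [unfold ht, padd, popp in *; cbn [fst snd]; lia | rewrite exy; exact h]. }
      rewrite exy in *; lra. }
    assert (hd' := gap_vopp th0 tau lc _ ltac:(lra) hd).
    assert (hk : (b < ht y - ht x)%Z).
    { apply Z.nle_gt. intro h.
      assert (rho <= nsq (V (padd y (popp x)))).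
      { apply hwin; [unfold ht, padd, popp in *; cbn [fst snd]; lia | rewrite eyx; exact hd']. }
      rewrite eyx, nsq_vopp in *; lra. }
    (* As [y] has height at most [a + b], [hk] leaves [x] below [a]: the opposite of [x] is in the
       window, and [x] is not a flipped point. *)
    assert (hox : gap (vopp (V x))).
    { destruct (cone_or_gap th0 tau lc (vopp (V x))) as [h|h]; auto;
        [lra | rewrite nsq_vopp; auto |].
      assert (rho <= nsq (V (popp x))).
      { apply hwin; [unfold ht, popp in *; cbn [fst snd]; lia | rewrite emb_opp; exact h]. }
      rewrite emb_opp, nsq_vopp in *; lra. }
    assert (cx : cone (V x)) by (destruct tx as [[h _]|[h _]]; [exact h | exfalso; lia]).
    destruct ty as [[cy my]|[_ cy]].
    - assert (h1 : nsq (V y) <= nsq (V (padd y (popp x)))).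
      { apply my; [unfold ht, padd, popp in *; cbn [fst snd]; lia | rewrite eyx; exact hd']. }
      rewrite eyx, nsq_vopp in h1.
      assert (h2 : nsq (V y) <= nsq (V x)) by (apply my; [lia | exact cx]).
      repeat split; auto. lra.
    (* If [y] is flipped, its opposite is in the cone although it is a sum of two gap vectors. *)
    - exfalso. apply (gap_vadd th0 tau lc _ _ htau hox hd).
      replace (vadd (vopp (V x)) (vsub (V x) (V y))) with (vopp (V y)); [exact cy|].
      unfold vadd, vopp, vsub; cbn [fst snd]; f_equal; ring. }
  intros hx hy hne hlt. destruct (Z.le_ge_cases (ht x) (ht y)).
  - left. auto.
  - right. apply key; auto. rewrite nsq_vsubC. assumption.
Qed.

Lemma close_pair_angle x y s t s' t' : 0 < s -> 0 < s' -> close_pair x y ->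
  vopp (V x) = (s * cos t, s * sin t) ->
  vsub (V x) (V y) = (s' * cos t', s' * sin t') -> cos (t - t') <= - (1 / 2).
Proof.
  intros hs hs' (_ & _ & h1 & h2) ex ed.
  assert (e1 : nsq (V x) = s ^ 2) by (rewrite <- nsq_vopp, ex; apply nsq_polar).
  assert (e2 : nsq (vsub (V x) (V y)) = s' ^ 2) by (rewrite ed; apply nsq_polar).
  assert (e3 : nsq (V y) = s ^ 2 + s' ^ 2 + 2 * (s * s' * cos (t - t'))).
  { rewrite <- nsq_polar_add, <- ex, <- ed, <- nsq_vopp. f_equal.
    unfold vadd, vopp, vsub; cbn [fst snd]; f_equal; ring. }
  apply (cos_le_of_short_sum s s'); lra.
Qed.

Definition distinct_norms (l : list (Z * Z * Z)) : Prop :=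
  NoDup l /\ forall x y, In x l -> In y l -> x <> y -> nsq (V x) <> nsq (V y).

Lemma distinct_norms_filter p l : distinct_norms l -> distinct_norms (filter p l).
Proof.
  intros [h1 h2]. split; [apply NoDup_filter; exact h1|].
  intros x y hx hy. apply filter_In in hx. apply filter_In in hy. apply h2; tauto.
Qed.

Lemma far_length_le5 l : distinct_norms l -> (forall x, In x l -> far x) ->
  (forall x y, In x l -> In y l -> ~ close_pair x y) -> (length l <= 5)%nat.
Proof.
  intros [hnd hne] hf hc. rewrite <- (length_map V). apply (separated_length rho). split.
  - apply Forall_forall. intros v hv. apply in_map_iff in hv.
    destruct hv as (x & <- & hx). apply hf in hx. apply hx.
  - assert (hs : forall x y, In x l -> In y l -> x <> y -> rho <= nsq (vsub (V x) (V y))).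
    { intros x y hx hy hxy. apply Rnot_lt_le. intro h.
      destruct (far_close x y); auto; [apply (hc x y) | apply (hc y x)]; auto. }
    clear hne hf hc. induction l as [|x l IH]; [constructor|].
    inversion_clear hnd as [|? ? hx hl]. simpl. constructor.
    + apply Forall_forall. intros v hv. apply in_map_iff in hv.
      destruct hv as (y & <- & hy). apply hs; simpl; auto. congruence.
    + apply IH; auto. intros; apply hs; simpl; auto.
Qed.

(** A half-open gap of angle at most 2 PI / 3 contains no two directions at angle 2 PI / 3; the
    excluded endpoint settles [tau = 4 * PI / 3]. *)
Lemma no_close_pair x y : 4 * PI / 3 <= tau -> ~ close_pair x y.
Proof.
  intros h43 h. assert (h' := h). destruct h' as (hx & hd & _).
  destruct hx as (s & t & hs & ht' & ex), hd as (s' & t' & hs' & ht'' & ed).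
  pose proof (close_pair_angle x y s t s' t' hs hs' h ex ed) as hc. pose proof PI_RGT_0.
  destruct (Rle_lt_dec t' t).
  - assert (2 * PI / 3 <= t - t') by (apply cos_obtuse; auto; destruct lc; lra).
    destruct lc; lra.
  - replace (t - t') with (- (t' - t)) in hc by ring. rewrite cos_neg in hc.
    assert (2 * PI / 3 <= t' - t) by (apply cos_obtuse; auto; destruct lc; lra).
    destruct lc; lra.
Qed.

Lemma far_outer_full w : tau = 2 * PI -> far w -> outer u v1 v2 a b rho w.
Proof.
  intros hfull hw. assert (h0 := far_nsq w hw). destruct hw as (kw & nw & tw).
  split; [|split; auto]. split; [|lia].
  destruct (Z_le_gt_dec (ht w) a) as [h|h]; [|lia]. exfalso.
  assert (rho <= nsq (V (popp w))).
  { apply hwin; [unfold ht, popp in *; cbn [fst snd]; lia|].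
    rewrite hfull. apply in_cone_full. rewrite emb_opp, nsq_vopp. exact h0. }
  rewrite emb_opp, nsq_vopp in *. lra.
Qed.

Lemma far_length_le4 l : tau = 2 * PI -> distinct_norms l ->
  (forall x, In x l -> far x) -> (length l <= 4)%nat.
Proof.
  intros hfull [hnd hne] hf. apply (outer_length_le4 u v1 v2 a b rho); auto.
  - intros w hw h0. destruct (Z_le_gt_dec (ht w) b) as [h|h].
    + apply hwin; [lia|]. rewrite hfull. apply in_cone_full. exact h0.
    + rewrite <- nsq_vopp, <- emb_opp. apply hwin; [unfold ht, popp in *; cbn [fst snd]; lia|].
      rewrite hfull. apply in_cone_full. rewrite emb_opp, nsq_vopp. exact h0.
  - apply Forall_forall. intros x hx. apply far_outer_full; auto.
  - apply NoDup_map_NoDup_ForallPairs; [|exact hnd].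
    intros x y hx hy e. apply NNPP. intro h. apply (hne x y); auto. congruence.
Qed.

(* [c + eps * th] with [eps = 1] (resp. [-1]) measures angles in the gap from
   its first (resp. last) boundary direction [c]. *)
Definition near_edge (c eps : R) (x : Z * Z * Z) : Prop :=
  exists s th, 0 < s /\ 0 <= th <= 4 * PI / 3 - tau /\
    vopp (V x) = (s * cos (c + eps * th), s * sin (c + eps * th)).

(** Another gap direction at angle at least 2 PI / 3 leaves at most [(2 * PI - tau) - 2 * PI / 3]
    between [vopp (V x)] and one edge. *)
Lemma close_pair_near_edge x y : close_pair x y ->
  near_edge (th0 + tau) 1 x \/ near_edge (th0 + 2 * PI) (-1) x.
Proof.
  intro h. assert (h' := h). destruct h' as (hx & hd & _).
  destruct hx as (s & t & hs & ht' & ex), hd as (s' & t' & hs' & ht'' & ed).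
  pose proof (close_pair_angle x y s t s' t' hs hs' h ex ed) as hc. pose proof PI_RGT_0.
  destruct (Rle_lt_dec t' t).
  - assert (2 * PI / 3 <= t - t') by (apply cos_obtuse; auto; destruct lc; lra).
    right. exists s, (th0 + 2 * PI - t). split; [exact hs|split; [destruct lc; lra|]].
    replace (th0 + 2 * PI + -1 * (th0 + 2 * PI - t)) with t by ring. exact ex.
  - replace (t - t') with (- (t' - t)) in hc by ring. rewrite cos_neg in hc.
    assert (2 * PI / 3 <= t' - t) by (apply cos_obtuse; auto; destruct lc; lra).
    left. exists s, (t - (th0 + tau)). split; [exact hs|split; [destruct lc; lra|]].
    replace (th0 + tau + 1 * (t - (th0 + tau))) with t by ring. exact ex.
Qed.

(** Any two points near the same edge form a close pair, so they are linearly ordered by decreasing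
    norm, ending at the shortest point [m]. The functional [gam] increases along this chain in steps
    of at least [q]. *)
Lemma near_edge_length c eps l : tau < 4 * PI / 3 ->
  (c = th0 + tau /\ eps = 1 \/ c = th0 + 2 * PI /\ eps = -1) ->
  distinct_norms l -> (forall x, In x l -> far x /\ near_edge c eps x) ->
  (Z.of_nat (length l) <= 1 + Int_part (sin (tau / 2 + PI / 6) / sin (tau - PI)))%Z.
Proof.
  intros h43 hce [hnd hne] hl. pose proof PI_RGT_0 as hPI.
  assert (hsin : 0 < sin (tau - PI)) by (apply sin_gt_0; lra).
  assert (hsin' : 0 < sin (tau / 2 + PI / 6)) by (apply sin_gt_0; lra).
  assert (hr0 : 0 <= sin (tau / 2 + PI / 6) / sin (tau - PI)).
  { apply Rlt_le, Rdiv_lt_0_compat; assumption. }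
  destruct (classic (l = [])) as [->|hl0].
  { apply (spaced_length _ (fun _ => 0)); [exact hr0 | constructor | intros ? [] | intros ? ? []]. }
  destruct (list_min _ (fun x => nsq (V x)) l hl0) as (m & hm & hmin).
  (* The determinant with the edge direction, signed so that it is nonnegative on the gap. *)
  set (gam := fun z : R * R => eps * (cos c * snd z - sin c * fst z)).
  assert (gE : forall s th, gam (s * cos (c + eps * th), s * sin (c + eps * th)) = s * sin th).
  { intros s th. unfold gam; cbn [fst snd].
    replace (eps * (cos c * (s * sin (c + eps * th)) - sin c * (s * cos (c + eps * th))))
      with (s * (eps * sin (c + eps * th - c))) by (rewrite sin_minus; ring).
    replace (c + eps * th - c) with (eps * th) by ring.
    destruct hce as [[_ ->]|[_ ->]].
    - rewrite !Rmult_1_l. reflexivity.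
    - replace (-1 * th) with (- th) by ring. rewrite sin_neg. ring. }
  assert (hcos : forall th th', cos (c + eps * th - (c + eps * th')) = cos (th - th')).
  { intros th th'. destruct hce as [[_ ->]|[_ ->]].
    - f_equal; ring.
    - rewrite <- cos_neg. f_equal; ring. }
  assert (hgap : forall z, gap z -> exists s th, 0 < s /\ 0 <= th <= 2 * PI - tau /\
            z = (s * cos (c + eps * th), s * sin (c + eps * th))).
  { intros z (s & t & hs & ht' & ->). exists s, (eps * (t - c)).
    destruct hce as [[-> ->]|[-> ->]]; (split; [exact hs|split; [destruct lc; lra|]]);
      do 2 f_equal; f_equal; ring. }
  assert (hstep : forall x y, In x l -> In y l -> close_pair x y ->
     gam (vopp (V x)) + sqrt (nsq (V m)) * sin (tau - PI) <= gam (vopp (V y))).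
  { intros x y hx hy hc. destruct (hl x hx) as [_ (s & th & hs & hth & ex)].
    assert (hc' := hc). destruct hc' as (_ & hd & hyd & _).
    destruct (hgap _ hd) as (s' & th' & hs' & hth' & ed).
    pose proof (close_pair_angle _ _ _ _ _ _ hs hs' hc ex ed) as hca. rewrite hcos in hca.
    assert (hth2 : 2 * PI / 3 <= th').
    { destruct (Rle_lt_dec th' th).
      - assert (2 * PI / 3 <= th - th') by (apply cos_obtuse; auto; lra). lra.
      - replace (th - th') with (- (th' - th)) in hca by ring. rewrite cos_neg in hca.
        assert (2 * PI / 3 <= th' - th) by (apply cos_obtuse; auto; lra). lra. }
    (* The angle [th'] lies between 2 PI / 3 and [2 * PI - tau], where the sine decreases. *)
    assert (hge : sin (tau - PI) <= sin th').
    { replace (tau - PI) with (PI - (2 * PI - tau)) by ring. rewrite sin_PI_x.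
      destruct (Req_dec th' (2 * PI - tau)) as [->|hne']; [lra|].
      apply Rlt_le, sin_decreasing_1; lra. }
    assert (hms : sqrt (nsq (V m)) <= s').
    { rewrite <- (sqrt_pow2 s') by lra. apply sqrt_le_1_alt.
      rewrite <- (nsq_polar s' (c + eps * th')), <- ed. pose proof (hmin y hy). cbv beta in *. lra. }
    assert (e : gam (vopp (V y)) = gam (vopp (V x)) + gam (vsub (V x) (V y)))
      by (unfold gam, vopp, vsub; cbn [fst snd]; ring).
    rewrite e. rewrite ed, gE. pose proof (sqrt_pos (nsq (V m))).
    apply Rplus_le_compat_l. apply Rmult_le_compat; lra. }
  assert (hclose : forall x y, In x l -> In y l -> x <> y -> close_pair x y \/ close_pair y x).
  { intros x y hx hy hxy. destruct (hl x hx) as [fx (s & th & hs & hth & ex)].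
    destruct (hl y hy) as [fy (s' & th' & hs' & hth' & ey)].
    apply far_close; auto.
    assert (e1 : nsq (V x) = s ^ 2) by (rewrite <- nsq_vopp, ex; apply nsq_polar).
    assert (e2 : nsq (V y) = s' ^ 2) by (rewrite <- nsq_vopp, ey; apply nsq_polar).
    assert (l1 : s ^ 2 < rho) by (rewrite <- e1; apply fx).
    assert (l2 : s' ^ 2 < rho) by (rewrite <- e2; apply fy).
    assert (e3 : nsq (vsub (V x) (V y)) + nsq (vadd (vopp (V x)) (vopp (V y))) =
                 2 * nsq (V x) + 2 * nsq (V y))
      by (unfold nsq, vsub, vadd, vopp; cbn [fst snd]; ring).
    rewrite e1, e2, ex, ey, nsq_polar_add, hcos in e3.
    (* The two angles differ by at most [4 * PI / 3 - tau], which is less than PI/3. *)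
    assert (hcp : 1 / 2 <= cos (th - th')).
    { rewrite <- cos_PI3. destruct (Rle_lt_dec th' th).
      - apply cos_decr_1; lra.
      - replace (th - th') with (- (th' - th)) by ring. rewrite cos_neg. apply cos_decr_1; lra. }
    assert (0 < s * s') by (apply Rmult_lt_0_compat; assumption).
    destruct (Rle_lt_dec s s'); nra. }
  assert (hgx : forall x, In x l -> 0 <= gam (vopp (V x)) /\
            gam (vopp (V x)) <= sqrt (nsq (V x)) * sin (tau / 2 + PI / 6)).
  { intros x hx. destruct (hl x hx) as [_ (s & th & hs & hth & ex)].
    rewrite <- (nsq_vopp (V x)), ex, gE, nsq_polar, sqrt_pow2 by lra. split.
    - apply Rmult_le_pos; [lra | apply sin_ge_0; lra].
    (* Since [tau > PI], the angle [th] is at most [PI - (tau / 2 + PI / 6)], itself below PI/2. *)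
    - apply Rmult_le_compat_l; [lra|]. rewrite <- (sin_PI_x (tau / 2 + PI / 6)).
      apply sin_incr_1; lra. }
  assert (hm0 : 0 < sqrt (nsq (V m))) by (apply sqrt_lt_R0, far_nsq, hl; exact hm).
  set (q := sqrt (nsq (V m)) * sin (tau - PI)) in *.
  assert (hq : 0 < q) by (apply Rmult_lt_0_compat; assumption).
  apply (spaced_length _ (fun x => gam (vopp (V x)) / q)); auto.
  - intros x hx. split; [apply Rmult_le_pos; [apply hgx; exact hx | apply Rlt_le, Rinv_0_lt_compat; exact hq]|].
    apply Rle_trans with (gam (vopp (V m)) / q).
    + apply Rmult_le_compat_r; [apply Rlt_le, Rinv_0_lt_compat; exact hq|].
      destruct (classic (x = m)) as [->|hxm]; [lra|].
      destruct (hclose x m hx hm hxm) as [h|h].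
      * apply hstep in h; auto. lra.
      (* A close pair starting at [m] would make [x] shorter than the minimum. *)
      * destruct h as (_ & _ & _ & h). pose proof (hmin x hx). cbv beta in *. lra.
    + replace (sin (tau / 2 + PI / 6) / sin (tau - PI)) with
        (sqrt (nsq (V m)) * sin (tau / 2 + PI / 6) / q) by (unfold q; field; lra).
      apply Rmult_le_compat_r; [apply Rlt_le, Rinv_0_lt_compat; exact hq|].
      apply hgx. exact hm.
  - intros x y hx hy hxy.
    replace (gam (vopp (V x)) / q - gam (vopp (V y)) / q)
      with ((gam (vopp (V x)) - gam (vopp (V y))) / q) by (field; lra).
    unfold Rdiv. rewrite Rabs_mult, (Rabs_pos_eq (/ q)) by (apply Rlt_le, Rinv_0_lt_compat; exact hq).
    apply (Rmult_le_reg_r q); [exact hq|]. rewrite Rmult_assoc, Rinv_l by lra.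
    rewrite Rmult_1_l, Rmult_1_r.
    destruct (hclose x y hx hy hxy) as [h|h]; apply hstep in h; auto.
    + rewrite Rabs_left1; lra.
    + rewrite Rabs_pos_eq; lra.
Qed.

(** Each edge accounts for at most one point more than the floor; the points near neither edge start
    no close pair, so they number at most five. *)
Lemma far_length l : tau < 4 * PI / 3 -> distinct_norms l -> (forall x, In x l -> far x) ->
  (Z.of_nat (length l) <= 7 + 2 * Int_part (sin (tau / 2 + PI / 6) / sin (tau - PI)))%Z.
Proof.
  intros h43 hl hf.
  set (p := fun x => if excluded_middle_informative (near_edge (th0 + tau) 1 x)
                     then true else false).
  set (q := fun x => if excluded_middle_informative (near_edge (th0 + 2 * PI) (-1) x)
                     then true else false).
  assert (hp : forall x, p x = true <-> near_edge (th0 + tau) 1 x).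
  { intro x. unfold p. destruct excluded_middle_informative; split; auto; discriminate. }
  assert (hq : forall x, q x = true <-> near_edge (th0 + 2 * PI) (-1) x).
  { intro x. unfold q. destruct excluded_middle_informative; split; auto; discriminate. }
  set (l1 := filter p l). set (l' := filter (fun x => negb (p x)) l).
  set (l2 := filter q l'). set (l3 := filter (fun x => negb (q x)) l').
  assert (e1 : (length l1 + length l' = length l)%nat) by apply filter_length.
  assert (e2 : (length l2 + length l3 = length l')%nat) by apply filter_length.
  assert (i' : forall x, In x l' -> In x l /\ p x = false).
  { intros x hx. apply filter_In in hx. rewrite Bool.negb_true_iff in hx. exact hx. }
  assert (d' : distinct_norms l') by (apply distinct_norms_filter; exact hl).
  assert (b1 := near_edge_length (th0 + tau) 1 l1 h43 ltac:(auto)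
            (distinct_norms_filter _ _ hl)).
  assert (b2 := near_edge_length (th0 + 2 * PI) (-1) l2 h43 ltac:(auto)
            (distinct_norms_filter _ _ d')).
  assert (b3 : (length l3 <= 5)%nat).
  { apply far_length_le5.
    - apply distinct_norms_filter; exact d'.
    - intros x hx. apply filter_In in hx. apply hf, i', hx.
    - intros x y hx hy hc. apply filter_In in hx. destruct hx as [hx hx2].
      apply i' in hx. apply Bool.negb_true_iff in hx2.
      destruct (close_pair_near_edge x y hc) as [h|h];
        [apply hp in h | apply hq in h]; destruct hx; congruence. }
  assert (h1 : forall x, In x l1 -> far x /\ near_edge (th0 + tau) 1 x).
  { intros x hx. apply filter_In in hx. destruct hx. split; [auto | apply hp; assumption]. }
  assert (h2 : forall x, In x l2 -> far x /\ near_edge (th0 + 2 * PI) (-1) x).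
  { intros x hx. apply filter_In in hx. destruct hx as [hx hx2].
    split; [apply hf, i'; assumption | apply hq; assumption]. }
  specialize (b1 h1). specialize (b2 h2). lia.
Qed.

End FarPoints.

(** * Nearest neighbour distances *)

Lemma dist_set_emb th0 tau lc a b c d alpha N n r :
  dist_set th0 tau lc a b c d alpha N n r <->
  exists w, (1 - Z.of_nat n <= ht w <= Z.of_nat N - Z.of_nat n)%Z /\
    in_cone th0 tau lc (emb alpha (a, b) (c, d) w) /\
    r = norm2 (emb alpha (a, b) (c, d) w).
Proof.
  split.
  - intros (m & l & hm & (i & j & ->) & hc). exists (i, j, (Z.of_nat m - Z.of_nat n)%Z).
    split; [unfold ht; cbn [snd]; lia|].
    replace (emb alpha (a, b) (c, d) (i, j, (Z.of_nat m - Z.of_nat n)%Z)) with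
      ((INR m - INR n) * fst alpha + fst (IZR i * a + IZR j * c, IZR i * b + IZR j * d),
       (INR m - INR n) * snd alpha + snd (IZR i * a + IZR j * c, IZR i * b + IZR j * d)).
    { exact hc. }
    unfold emb; cbn [fst snd]. rewrite minus_IZR, <- !INR_IZR_INZ. f_equal; ring.
  - intros ([[i j] k] & hk & hc). unfold ht in hk; cbn [snd] in hk.
    exists (Z.to_nat (k + Z.of_nat n)), (IZR i * a + IZR j * c, IZR i * b + IZR j * d).
    split; [lia|]. split; [exists i, j; reflexivity|].
    replace (emb alpha (a, b) (c, d) (i, j, k)) with
      ((INR (Z.to_nat (k + Z.of_nat n)) - INR n) * fst alpha
         + fst (IZR i * a + IZR j * c, IZR i * b + IZR j * d),
       (INR (Z.to_nat (k + Z.of_nat n)) - INR n) * snd alpha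
         + snd (IZR i * a + IZR j * c, IZR i * b + IZR j * d)) in hc.
    { exact hc. }
    unfold emb; cbn [fst snd]. rewrite INR_IZR_INZ, Z2Nat.id by lia.
    rewrite plus_IZR, <- INR_IZR_INZ. f_equal; ring.
Qed.

Lemma emb_reflect alpha v1 v2 i j k :
  emb (vopp alpha) v1 v2 (i, j, (- k)%Z) = emb alpha v1 v2 (i, j, k).
Proof. unfold emb, vopp; cbn [fst snd]. rewrite opp_IZR. f_equal; ring. Qed.

(** Negating both [alpha] and the height preserves the planar vector and exchanges the indices [n]
    and [N + 1 - n]. *)
Lemma dist_set_reflect th0 tau lc a b c d alpha N n r : (1 <= n <= N)%nat ->
  dist_set th0 tau lc a b c d alpha N n r <->
  dist_set th0 tau lc a b c d (vopp alpha) N (N + 1 - n) r.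
Proof.
  intro hn. rewrite !dist_set_emb. split; intros ([[i j] k] & hk & hc).
  - exists (i, j, (- k)%Z). unfold ht in *; cbn [snd] in *. rewrite emb_reflect.
    split; [lia | exact hc].
  - exists (i, j, (- k)%Z). unfold ht in *; cbn [snd] in *.
    rewrite <- emb_reflect, Z.opp_involutive. split; [lia | exact hc].
Qed.

Lemma is_delta_reflect th0 tau lc a b c d alpha N n r : (1 <= n <= N)%nat ->
  is_delta th0 tau lc a b c d alpha N n r ->
  is_delta th0 tau lc a b c d (vopp alpha) N (N + 1 - n) r.
Proof.
  intros hn [h1 h2]. split; [rewrite <- dist_set_reflect; assumption|].
  intros s hs. apply h2. rewrite dist_set_reflect; assumption.
Qed.

Definition delta_value th0 tau lc a b c d alpha N (r : R) : Prop :=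
  exists n, (1 <= n <= N)%nat /\ is_delta th0 tau lc a b c d alpha N n r.

(** Each index has at most one minimum, so a duplicate-free list of exactly all the distances can be
    built index by index. *)
Lemma gN_le_of_NoDup th0 tau lc a b c d alpha N K :
  (forall l, NoDup l -> (forall r, In r l -> delta_value th0 tau lc a b c d alpha N r) ->
     (Z.of_nat (length l) <= K)%Z) ->
  gN_le th0 tau lc a b c d alpha N K.
Proof.
  intro H.
  assert (hex : forall k, exists l, NoDup l /\ forall r, In r l <->
    exists n, (1 <= n <= k)%nat /\ is_delta th0 tau lc a b c d alpha N n r).
  { induction k as [|k (l & hnd & hl)].
    - exists []. split; [constructor|]. intro r. split; [intros []|intros (n & hn & _); lia].
    - assert (hle : forall r, (exists n, (1 <= n <= k)%nat /\
                is_delta th0 tau lc a b c d alpha N n r) ->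
              exists n, (1 <= n <= S k)%nat /\ is_delta th0 tau lc a b c d alpha N n r).
      { intros r (n & hn & hr). exists n. split; [lia | exact hr]. }
      destruct (classic (exists r, is_delta th0 tau lc a b c d alpha N (S k) r /\ ~ In r l))
        as [(r & hr & hrl)|hno].
      + exists (r :: l). split; [constructor; assumption|]. intro r'. split.
        * intros [<-|hr']; [exists (S k); split; [lia | exact hr] | apply hle, hl, hr'].
        * intros (n & hn & hr'). destruct (Nat.eq_dec n (S k)) as [->|hne].
          -- left. apply Rle_antisym; [apply hr, hr' | apply hr', hr].
          -- right. apply hl. exists n. split; [lia | exact hr'].
      + exists l. split; [exact hnd|]. intro r'. split; [intro h; apply hle, hl, h|].
        intros (n & hn & hr'). destruct (Nat.eq_dec n (S k)) as [->|hne].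
        * apply NNPP. intro h. apply hno. exists r'. auto.
        * apply hl. exists n. split; [lia | exact hr']. }
  destruct (hex N) as (l & hnd & hl). exists l. split.
  - apply H; [exact hnd|]. intros r hr. apply hl in hr. exact hr.
  - intros n hn r hr. apply hl. exists n. auto.
Qed.

(** The window of the index [n] has [A = n - 1] and [B = N - n], with [B <= A] by the second
    hypothesis. A shorter distance is realised above [B] or below [- A]; in the latter case the
    opposite point is kept. *)
Lemma far_list_aux th0 tau lc a b c d alpha N n rho l :
  (1 <= n <= N)%nat -> (N + 1 <= 2 * n)%nat -> is_delta th0 tau lc a b c d alpha N n rho ->
  NoDup l -> (forall r, In r l -> delta_value th0 tau lc a b c d alpha N r /\ r < rho) ->
  exists A B L, (0 <= B <= A)%Z /\
    (forall w, (- A <= ht w <= B)%Z -> in_cone th0 tau lc (emb alpha (a, b) (c, d) w) ->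
       rho ^ 2 <= nsq (emb alpha (a, b) (c, d) w)) /\
    distinct_norms alpha (a, b) (c, d) L /\
    (forall x, In x L -> far alpha (a, b) (c, d) th0 tau lc A B (rho ^ 2) x) /\
    length L = length l.
Proof.
  intros hn hmid hdelta hnd hl.
  set (V := emb alpha (a, b) (c, d)).
  assert (hwin : forall w, (1 - Z.of_nat n <= ht w <= Z.of_nat N - Z.of_nat n)%Z ->
            in_cone th0 tau lc (V w) -> rho <= norm2 (V w)).
  { intros w hw hc. apply hdelta. apply dist_set_emb. exists w. auto. }
  assert (hrho : 0 <= rho).
  { destruct hdelta as [h _]. apply dist_set_emb in h. destruct h as (w & _ & _ & ->).
    apply sqrt_pos. }
  assert (hsq : forall v, norm2 v ^ 2 = nsq v).
  { intro v. unfold norm2. apply pow2_sqrt, nsq_ge0. }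
  assert (hpos : forall v, 0 <= norm2 v) by (intro; apply sqrt_pos).
  set (A := (Z.of_nat n - 1)%Z). set (B := (Z.of_nat N - Z.of_nat n)%Z).
  assert (hfar : forall r, In r l -> exists w, norm2 (V w) = r /\
            far alpha (a, b) (c, d) th0 tau lc A B (rho ^ 2) w).
  { intros r hr. destruct (hl r hr) as [(k & hk & hr1 & hr2) hlt].
    apply dist_set_emb in hr1. destruct hr1 as (w & hw & hc & e). fold V in hc, e.
    assert (hmin : forall z, (1 - Z.of_nat k <= ht z <= Z.of_nat N - Z.of_nat k)%Z ->
              in_cone th0 tau lc (V z) -> nsq (V w) <= nsq (V z)).
    { intros z hz hcz. rewrite <- !hsq. apply pow_incr. split; [apply hpos|].
      rewrite <- e. apply hr2. apply dist_set_emb. exists z. auto. }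
    assert (hlt' : nsq (V w) < rho ^ 2).
    { rewrite <- hsq, <- e. pose proof (hpos (V w)). rewrite <- e in *. nra. }
    destruct (Z_le_gt_dec (ht w) B) as [h|h].
    - destruct (Z_le_gt_dec (- A) (ht w)) as [h'|h'].
      + exfalso. assert (rho <= norm2 (V w)) by (apply hwin; [unfold A, B in *; lia | exact hc]).
        lra.
      + assert (eV : V (popp w) = vopp (V w)) by apply emb_opp.
        assert (hh : ht (popp w) = (- ht w)%Z) by reflexivity.
        exists (popp w). rewrite eV. split.
        * rewrite e. unfold norm2. f_equal. apply nsq_vopp.
        * split; [unfold A, B in *; lia|]. fold V. rewrite eV, nsq_vopp.
          split; [exact hlt'|]. right. split; [unfold A, B in *; lia|].
          replace (vopp (vopp (V w))) with (V w); [exact hc|].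
          unfold vopp; cbn [fst snd]. rewrite !Ropp_involutive. apply surjective_pairing.
    (* The window of [k] contains both 0 and the height of [w], so the minimality of [w] covers all
       heights in between. *)
    - exists w. split; [auto|]. split; [unfold A, B in *; lia|]. split; [exact hlt'|].
      left. split; [exact hc|]. intros z hz. apply hmin. lia. }
  assert (hL : exists L, map (fun w => norm2 (V w)) L = l /\
            forall x, In x L -> far alpha (a, b) (c, d) th0 tau lc A B (rho ^ 2) x).
  { clear hl hnd. induction l as [|r l IH]; [exists []; split; [reflexivity | intros ? []]|].
    destruct IH as (L & e & hL); [intros; apply hfar; simpl; auto|].
    destruct (hfar r (or_introl eq_refl)) as (w & ew & hw).
    exists (w :: L). split; [simpl; congruence|]. intros x [<-|hx]; auto. }
  destruct hL as (L & eL & hL). exists A, B, L.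
  split; [unfold A, B; lia|]. split; [|split; [|split; [exact hL|]]].
  - intros w hw hc. fold V in hc |- *. rewrite <- hsq. apply pow_incr.
    split; [exact hrho | apply hwin; [unfold A, B in *; lia | exact hc]].
  - rewrite <- eL in hnd. split; [apply (NoDup_map_inv _ _ hnd)|].
    clear eL hL. induction L as [|w L IH]; [intros ? ? []|].
    simpl in hnd. inversion_clear hnd as [|? ? hw hnd'].
    intros x y [<-|hx] [<-|hy] hxy e; [congruence| | |apply (IH hnd' x y hx hy hxy e)].
    + apply hw. apply in_map_iff. exists y. split; [|exact hy]. unfold norm2. f_equal.
      symmetry. exact e.
    + apply hw. apply in_map_iff. exists x. split; [|exact hx]. unfold norm2. f_equal. exact e.
  - rewrite <- eL. symmetry. apply length_map.
Qed.

Lemma far_list th0 tau lc a b c d alpha N l :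
  l <> [] -> NoDup l -> (forall r, In r l -> delta_value th0 tau lc a b c d alpha N r) ->
  exists u A B rho L, (0 <= B <= A)%Z /\
    (forall w, (- A <= ht w <= B)%Z -> in_cone th0 tau lc (emb u (a, b) (c, d) w) ->
       rho <= nsq (emb u (a, b) (c, d) w)) /\
    distinct_norms u (a, b) (c, d) L /\
    (forall x, In x L -> far u (a, b) (c, d) th0 tau lc A B rho x) /\
    length l = S (length L).
Proof.
  (* Minimising [Ropp] selects the largest distance. *)
  intros hne hnd hl. destruct (list_min _ Ropp l hne) as (rho & hrho & hmax).
  destruct (in_split _ _ hrho) as (l1 & l2 & ->).
  destruct (hl rho hrho) as (n & hn & hdelta).
  assert (hlt : forall r, In r (l1 ++ l2) -> r < rho).
  { intros r hr. destruct (hmax r) as [h|h]; [|lra|].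
    - rewrite in_app_iff in *. simpl. tauto.
    - apply NoDup_remove_2 in hnd. exfalso. apply hnd. replace rho with r by lra. exact hr. }
  assert (hl' : forall r, In r (l1 ++ l2) -> delta_value th0 tau lc a b c d alpha N r).
  { intros r hr. apply hl. rewrite in_app_iff in *. simpl. tauto. }
  apply NoDup_remove_1 in hnd.
  assert (elen : length (l1 ++ rho :: l2) = S (length (l1 ++ l2)))
    by (rewrite !length_app; simpl; lia).
  rewrite elen. destruct (le_gt_dec (N + 1) (2 * n)) as [h|h].
  - destruct (far_list_aux th0 tau lc a b c d alpha N n rho (l1 ++ l2))
      as (A & B & L & h1 & h2 & h3 & h4 & h5); auto.
    exists alpha, A, B, (rho ^ 2), L. rewrite h5. auto.
  - destruct (far_list_aux th0 tau lc a b c d (vopp alpha) N (N + 1 - n) rho (l1 ++ l2))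
      as (A & B & L & h1 & h2 & h3 & h4 & h5); auto; try lia.
    + apply is_delta_reflect; assumption.
    + intros r hr. split; [|auto]. destruct (hl' r hr) as (k & hk & hd).
      exists (N + 1 - k)%nat. split; [lia | apply is_delta_reflect; assumption].
    + exists (vopp alpha), A, B, (rho ^ 2), L. rewrite h5. auto.
Qed.

Theorem theorem1p4 (th0 tau : R) (lc : bool) (a b c d : R) (alpha : R * R)
    (N : nat) :
  PI < tau <= 2 * PI ->
  Rabs (a * d - b * c) = 1 ->
  (tau = 2 * PI -> gN_le th0 tau lc a b c d alpha N 5) /\
  (5 * PI / 3 < tau < 2 * PI -> gN_le th0 tau lc a b c d alpha N 9) /\
  (tau = 5 * PI / 3 -> gN_le th0 tau lc a b c d alpha N 8) /\
  (4 * PI / 3 < tau < 5 * PI / 3 -> gN_le th0 tau lc a b c d alpha N 9) /\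
  (tau = 4 * PI / 3 -> gN_le th0 tau lc a b c d alpha N 8) /\
  (PI < tau < 4 * PI / 3 ->
     gN_le th0 tau lc a b c d alpha N
       (12 + 2 * Int_part (sin (tau / 2 + PI / 6) / sin (tau - PI)))%Z).
Proof.
  intros htau _. pose proof PI_RGT_0 as hPI.
  assert (H : forall K, (0 <= K)%Z ->
    (forall u A B rho L, (0 <= B <= A)%Z ->
      (forall w, (- A <= ht w <= B)%Z -> in_cone th0 tau lc (emb u (a, b) (c, d) w) ->
         rho <= nsq (emb u (a, b) (c, d) w)) ->
      distinct_norms u (a, b) (c, d) L ->
      (forall x, In x L -> far u (a, b) (c, d) th0 tau lc A B rho x) ->
      (Z.of_nat (length L) + 1 <= K)%Z) -> gN_le th0 tau lc a b c d alpha N K).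
  { intros K hK hb. apply gN_le_of_NoDup. intros l hnd hl.
    destruct (classic (l = [])) as [->|hne]; [exact hK|].
    destruct (far_list th0 tau lc a b c d alpha N l hne hnd hl)
      as (u & A & B & rho & L & h1 & h2 & h3 & h4 & h5).
    specialize (hb u A B rho L h1 h2 h3 h4). lia. }
  (* At most five far points together with the largest distance give six values. *)
  assert (H6 : 4 * PI / 3 <= tau -> forall K, (6 <= K)%Z ->
            gN_le th0 tau lc a b c d alpha N K).
  { intros h43 K hK. apply H; [lia|]. intros u A B rho L h1 h2 h3 h4.
    assert (length L <= 5)%nat; [|lia].
    apply (far_length_le5 u (a, b) (c, d) th0 tau lc A B rho); auto.
    intros x y _ _. eapply no_close_pair; eassumption. }
  repeat split; intro h; try (apply H6; [lra | lia]).
  - apply H; [lia|]. intros u A B rho L h1 h2 h3 h4.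
    assert (length L <= 4)%nat; [|lia].
    apply (far_length_le4 u (a, b) (c, d) th0 tau lc A B rho); auto.
  (* Nonnegativity of the floor makes the bound valid for the empty list of distances too. *)
  - assert (h0 : (0 <= Int_part (sin (tau / 2 + PI / 6) / sin (tau - PI)))%Z).
    { destruct (base_Int_part (sin (tau / 2 + PI / 6) / sin (tau - PI))) as [_ hi].
      assert (0 < sin (tau / 2 + PI / 6) / sin (tau - PI)).
      { apply Rdiv_lt_0_compat; apply sin_gt_0; lra. }
      apply Z.lt_succ_r, lt_IZR. unfold Z.succ. rewrite plus_IZR. lra. }
    apply H; [lia|]. intros u A B rho L h1 h2 h3 h4.
    pose proof (far_length u (a, b) (c, d) th0 tau lc A B rho htau h1 h2 L
                  (proj2 h) h3 h4). lia.
Qed.
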